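(* Let $\tau$ be any (invertible) ergodic measure-preserving transformation of a non-atomic probability space $(X,m)$. Given a sequence of probability measures $(\mu_k)_{k\ge1}$ on $\mathbb{Z}$, the following are equivalent: (a) the series $\sum_{k=1}^\infty\left(\mu_{k+1}f-\mu_kf\right)$ is unconditionally convergent in $L^2(X,m)$ for all $f\in L^2(X,m)$; (b) $\displaystyle\sup_{|\gamma|=1}\sum_{k=1}^\infty\left|\widehat\mu_{k+1}(\gamma)-\widehat\mu_k(\gamma)\right|<\infty$.
   Context: For a probability measure $\mu$ on $\mathbb{Z}$, $\mu f(x)=\sum_{s=-\infty}^\infty\mu(s)f(\tau^s(x))$, and $\widehat\mu(\gamma)=\sum_{s=-\infty}^\infty\mu(s)\gamma^s$ for $\gamma\in\mathbb{C}$, $|\gamma|=1$. A series $\sum_{k=1}^\infty f_k$ in a Banach space is unconditionally convergent if $\sum_{k=1}^\infty f_{\pi(k)}$ converges in norm for every permutation $\pi$ of $\{1,2,3,\dots\}$. *)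

(* Defs.v *)
From HB Require Import structures.
From mathcomp Require Import all_boot all_order all_algebra complex.
From mathcomp Require Import all_classical all_reals all_analysis.
Set Implicit Arguments.
Unset Strict Implicit.
Unset Printing Implicit Defensive.
Import Order.TTheory GRing.Theory Num.Theory.
Import numFieldNormedType.Exports.
Local Open Scope classical_set_scope.
Local Open Scope ring_scope.

(* The integers carry the discrete sigma-algebra, as [nat] does in the library
   (whose measurable types are pointed), so that [probability int R] is the type
   of probability measures on Z. *)
HB.instance Definition _ := isPointed.Build int 0.
HB.instance Definition _ := @isMeasurable.Build default_measure_display
  int discrete_measurable discrete_measurable0
  discrete_measurableC discrete_measurableU.

Section dynamics.
Context {d : measure_display} {X : measurableType d} {R : realType}.
Implicit Types (m : probability X R) (tau tauV : X -> X) (A : set X).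

Definition atom m A : Prop :=
  [/\ measurable A, (0 < m A)%E &
      forall B, measurable B -> B `<=` A -> m B = 0%E \/ m B = m A].

Definition non_atomic m : Prop := forall A, ~ atom m A.

Definition measure_preserving m tau : Prop :=
  measurable_fun setT tau /\
  forall A, measurable A -> m (tau @^-1` A) = m A.

Definition measurable_inverse tau tauV : Prop :=
  [/\ cancel tau tauV, cancel tauV tau & measurable_fun setT tauV].

Definition ergodic m tau : Prop :=
  forall A, measurable A -> tau @^-1` A = A -> m A = 0%E \/ m A = 1%E.

End dynamics.

Definition ziter {X : Type} (tau tauV : X -> X) (s : int) : X -> X :=
  match s with
  | Posz n => iter n tau
  | Negz n => iter n.+1 tauV
  end.

Section averages.
Context {R : realType}.

(* [R[i]^o] is [R[i]] seen as a normed space over itself, which is where the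
   library puts the topology of C. *)
Definition zsum (a : int -> R[i]) : R[i] :=
  limn (series (fun n => a (Posz n) : R[i]^o))
  + limn (series (fun n => a (Negz n) : R[i]^o)).

Definition mass (mu : probability int R) (s : int) : R[i] :=
  (fine (mu [set s]))%:C%C.

(* For f in L^2 the series converges absolutely at almost every x; elsewhere
   [limn] returns a default value, on a null set. *)
Definition average {X : Type} (tau tauV : X -> X) (mu : probability int R)
    (f : X -> R[i]) (x : X) : R[i] :=
  zsum (fun s => mass mu s * f (ziter tau tauV s x)).

Definition fourier (mu : probability int R) (gamma : R[i]) : R[i] :=
  zsum (fun s => mass mu s * gamma ^ s).

(* The modulus as an element of R; the generic norm [`|z|] lies in [R[i]]. *)
Definition modulus (z : R[i]) : R := complex.Re `|z|.

End averages.

Section L2.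
Context {d : measure_display} {X : measurableType d} {R : realType}.
Variable m : probability X R.

Definition L2norm (f : X -> R[i]) : \bar R :=
  Lnorm m 2%:E (fun x => (modulus (f x))%:E).

(* Square-integrable complex-valued functions, not quotiented by equality a.e.;
   equality in L^2 is [L2norm] of the difference being zero. *)
Definition in_L2 (f : X -> R[i]) : Prop :=
  [/\ measurable_fun setT (fun x => complex.Re (f x)),
      measurable_fun setT (fun x => complex.Im (f x)) &
      (L2norm f < +oo)%E].

Definition L2_cvg_to (u : nat -> X -> R[i]) (g : X -> R[i]) : Prop :=
  L2norm (fun x => u n x - g x) @[n --> \oo] --> 0%E.

Definition L2_series_converges (F : nat -> X -> R[i]) : Prop :=
  exists g, in_L2 g /\ L2_cvg_to (fun n x => \sum_(0 <= k < n) F k x) g.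

Definition L2_series_converges_unconditionally (F : nat -> X -> R[i]) : Prop :=
  forall pi : nat -> nat, bijective pi ->
    L2_series_converges (fun k => F (pi k)).

End L2.

(* Main.v *)
Require Import Defs.
From mathcomp Require Import all_boot all_order all_algebra complex.
From mathcomp Require Import all_classical all_reals all_analysis.
From mathcomp Require cyclic separable cyclotomic.
From mathcomp Require Import measurable_realfun ring lra.
Set Implicit Arguments.
Unset Strict Implicit.
Unset Printing Implicit Defensive.
Import Order.TTheory GRing.Theory Num.Theory.
Import numFieldNormedType.Exports.
Local Open Scope classical_set_scope.
Local Open Scope ring_scope.

(** The averages are functions of one operator, the Koopman operator
    [U : f |-> f \o tau], which is unitary on L2: the average by a measure [mu]
    is the value at [U] of the function [fourier mu] on the unit circle.  The
    theorem compares norms of functions of [U] with suprema over the circle of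
    these functions.

    From bounded symbols to unconditional convergence.  If the sums of the
    [modulus (fourier (mu k.+1) g - fourier (mu k) g)] are at most [M] for all
    [g], then each combination, with coefficients of modulus at most 1, of
    finitely many differences has a symbol bounded by [M]; by Von Neumann's
    inequality ([mult_norm_le_symb]) the same combination of the functions in
    the series has norm at most [M] times that of [f].  The inequality is
    obtained by transference: along an orbit, a polynomial in [U] acts as a
    convolution on the integers ([koopman_polynomial_bound]), and convolutions
    on a window are diagonalised by the characters of a large cyclic group
    ([convolution_bound]).  In a Hilbert space, a series with bounded signed
    partial sums converges, by the parallelogram law
    ([bounded_signs_cauchy]); as the bound ignores the order of the terms, this
    applies to every rearrangement.

    From unconditional convergence to bounded symbols.  For a given [f], the
    sums over finite sets of indices are bounded, for otherwise some
    rearrangement diverges ([unconditional_bounded]); the uniform boundedness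
    principle ([uniform_boundedness]) makes the bound proportional to the norm
    of [f].  As the space has no atoms and [tau] is ergodic, there are towers of
    every height ([tower]), which carry approximate eigenvectors of [U] for any
    [g] on the circle ([approximate_eigenvector]); thus the symbols of these
    sums at [g] are bounded by the norms of the operators
    ([symb_le_mult_norm]).  Finally, four subset sums (positive and negative
    parts of the real and imaginary parts) control a sum of moduli.

    The averages are pointwise sums of series that are only known to converge
    almost everywhere.  [L2_series_limn] shows that such a pointwise sum,
    default values included, is a sum in norm with an explicit remainder; it
    yields both the completeness of L2 and the approximation of averages by
    finite combinations of powers of [U]. *)

(** * The modulus and convergence in the complex plane *)

Section modulus.
Context {R : realType}.
Implicit Types (z w : R[i]) (r : R).

Lemma normE z : `|z| = (modulus z)%:C%C.
Proof. by rewrite /modulus; case: z => a b; rewrite normc_def. Qed.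

Lemma modulusE z :
  modulus z = Num.sqrt (complex.Re z ^+ 2 + complex.Im z ^+ 2).
Proof. by rewrite /modulus normc_def. Qed.

Lemma modulus_ge0 z : 0 <= modulus z.
Proof. by rewrite modulusE sqrtr_ge0. Qed.

Lemma sqr_modulus z : modulus z ^+ 2 = complex.Re z ^+ 2 + complex.Im z ^+ 2.
Proof. by rewrite modulusE sqr_sqrtr// addr_ge0// sqr_ge0. Qed.

Lemma modulus0 : modulus (0 : R[i]) = 0.
Proof. by rewrite /modulus normr0. Qed.

Lemma modulus1 : modulus (1 : R[i]) = 1.
Proof. by rewrite /modulus normr1. Qed.

Lemma modulusN z : modulus (- z) = modulus z.
Proof. by rewrite /modulus normrN. Qed.

Lemma modulusM z w : modulus (z * w) = modulus z * modulus w.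
Proof. by apply: (@complexI R); rewrite -normE normrM !normE -rmorphM. Qed.

Lemma modulusX z n : modulus (z ^+ n) = modulus z ^+ n.
Proof. by apply: (@complexI R); rewrite -normE normrX !normE -rmorphXn. Qed.

Lemma modulusV z : modulus z^-1 = (modulus z)^-1.
Proof. by apply: (@complexI R); rewrite -normE normfV !normE -fmorphV. Qed.

Lemma modulusD z w : modulus (z + w) <= modulus z + modulus w.
Proof. by rewrite -lecR rmorphD /= -!normE ler_normD. Qed.

Lemma modulusB z w : modulus (z - w) <= modulus z + modulus w.
Proof. by rewrite (le_trans (modulusD _ _))// modulusN. Qed.

Lemma modulus_dist z w : modulus (z - w) = modulus (w - z).
Proof. by rewrite -modulusN opprB. Qed.

Lemma modulus_sum I (s : seq I) (P : pred I) (F : I -> R[i]) :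
  modulus (\sum_(i <- s | P i) F i) <= \sum_(i <- s | P i) modulus (F i).
Proof.
elim/big_rec2 : _ => [|i x z _ le]; first by rewrite modulus0.
by rewrite (le_trans (modulusD _ _))// lerD2l.
Qed.

Lemma modulus_real r : 0 <= r -> modulus r%:C%C = r.
Proof. by move=> r0; rewrite modulusE /= expr0n addr0 sqrtr_sqr ger0_norm. Qed.

Lemma modulus_Re z : `|complex.Re z| <= modulus z.
Proof. by rewrite modulusE -sqrtr_sqr ler_wsqrtr// lerDl sqr_ge0. Qed.

Lemma modulus_Im z : `|complex.Im z| <= modulus z.
Proof. by rewrite modulusE -sqrtr_sqr ler_wsqrtr// lerDr sqr_ge0. Qed.

Lemma modulus_le_ReIm z : modulus z <= `|complex.Re z| + `|complex.Im z|.
Proof.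
rewrite modulusE -[leRHS]ger0_norm ?addr_ge0// -sqrtr_sqr ler_wsqrtr// sqrrD.
by rewrite !real_normK ?num_real// -addrA lerD2l lerDr mulrn_wge0// mulr_ge0.
Qed.

Lemma modulus_unit z : `|z| = 1 -> modulus z = 1.
Proof. by rewrite /modulus => ->. Qed.

Lemma modulus_parallelogram z w :
  modulus (z + w) ^+ 2 + modulus (z - w) ^+ 2 =
  2 * modulus z ^+ 2 + 2 * modulus w ^+ 2.
Proof.
rewrite !sqr_modulus; case: z => a b; case: w => c e /=.
by rewrite !sqrrD !sqrrN !mulrN; ring.
Qed.

Lemma ReD z w : complex.Re (z + w) = complex.Re z + complex.Re w.
Proof. by case: z => a b; case: w. Qed.

Lemma ImD z w : complex.Im (z + w) = complex.Im z + complex.Im w.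
Proof. by case: z => a b; case: w. Qed.

Lemma ReN z : complex.Re (- z) = - complex.Re z. Proof. by case: z. Qed.
Lemma ImN z : complex.Im (- z) = - complex.Im z. Proof. by case: z. Qed.

Lemma ReM z w :
  complex.Re (z * w) = complex.Re z * complex.Re w - complex.Im z * complex.Im w.
Proof. by case: z => a b; case: w. Qed.

Lemma ImM z w :
  complex.Im (z * w) = complex.Re z * complex.Im w + complex.Im z * complex.Re w.
Proof. by case: z => a b; case: w. Qed.

Lemma Re_sum I (s : seq I) (P : pred I) (F : I -> R[i]) :
  complex.Re (\sum_(i <- s | P i) F i) = \sum_(i <- s | P i) complex.Re (F i).
Proof. by apply: (big_morph _ ReD). Qed.

Lemma Im_sum I (s : seq I) (P : pred I) (F : I -> R[i]) :
  complex.Im (\sum_(i <- s | P i) F i) = \sum_(i <- s | P i) complex.Im (F i).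
Proof. by apply: (big_morph _ ImD). Qed.

End modulus.

Section complex_limits.
Context {R : realType}.
Implicit Types (u : nat -> R[i]) (a : nat -> R) (A : R).

Lemma ccvgP u (l : R[i]) :
  ((u : nat -> R[i]^o) n @[n --> \oo] --> (l : R[i]^o)) <->
  (modulus (u n - l) @[n --> \oo] --> (0 : R)).
Proof.
split=> [/cvgrPdist_lt h|/cvgrPdist_lt h].
  apply/cvgrPdist_lt => e e0; have := h e%:C%C; rewrite ltcR => /(_ e0).
  apply: filterS => n; rewrite normE ltcR sub0r normrN ger0_norm ?modulus_ge0//.
  by rewrite modulus_dist.
apply/cvgrPdist_lt => -[e e']; rewrite ltcE /= => /andP[/eqP -> e0].
move/(_ _ e0): h; apply: filterS => n.
rewrite sub0r normrN ger0_norm ?modulus_ge0// => h.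
by rewrite normE -/(real_complex R e) ltcR modulus_dist.
Qed.

Lemma Re_cvg u (l : R[i]) : (u : nat -> R[i]^o) n @[n --> \oo] --> (l : R[i]^o) ->
  complex.Re (u n) @[n --> \oo] --> complex.Re l.
Proof.
move/ccvgP/cvgrPdist_lt => h; apply/cvgrPdist_lt => e /h; apply: filterS => n.
rewrite sub0r normrN ger0_norm ?modulus_ge0//; apply: le_lt_trans.
by rewrite distrC -ReN -ReD modulus_Re.
Qed.

Lemma Im_cvg u (l : R[i]) : (u : nat -> R[i]^o) n @[n --> \oo] --> (l : R[i]^o) ->
  complex.Im (u n) @[n --> \oo] --> complex.Im l.
Proof.
move/ccvgP/cvgrPdist_lt => h; apply/cvgrPdist_lt => e /h; apply: filterS => n.
rewrite sub0r normrN ger0_norm ?modulus_ge0//; apply: le_lt_trans.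
by rewrite distrC -ImN -ImD modulus_Im.
Qed.

Lemma ReIm_cvg u (a b : R) : complex.Re (u n) @[n --> \oo] --> a ->
  complex.Im (u n) @[n --> \oo] --> b ->
  (u : nat -> R[i]^o) n @[n --> \oo] --> (Complex a b : R[i]^o).
Proof.
move=> ha hb; apply/ccvgP.
apply: (@squeeze_cvgr _ _ _ _ (fun=> 0)
  (fun n => `|complex.Re (u n) - a| + `|complex.Im (u n) - b|)).
- apply: nearW => n; rewrite modulus_ge0/= (le_trans (modulus_le_ReIm _))//.
  by rewrite !(ReD, ImD, ReN, ImN).
- exact: cvg_cst.
rewrite -[X in _ --> X](addr0 (0 : R)); apply: cvgD.
  by rewrite -[X in _ --> X](@normr0 _ R); apply: cvg_norm; apply/subr_cvg0.
by rewrite -[X in _ --> X](@normr0 _ R); apply: cvg_norm; apply/subr_cvg0.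
Qed.

Lemma clim_unique u (l : R[i]) :
  (u : nat -> R[i]^o) n @[n --> \oo] --> (l : R[i]^o) ->
  limn (u : nat -> R[i]^o) = l.
Proof. by move=> h; apply: cvg_lim => //; exact: norm_hausdorff. Qed.

Lemma bounded_series_cvg a A : (forall n, 0 <= a n) ->
  (forall n, \sum_(0 <= k < n) a k <= A) -> cvgn (series a).
Proof.
move=> a0 aA; apply: nondecreasing_is_cvgn.
  by apply/nondecreasing_seqP => n; rewrite seriesSr lerDl.
by exists A => _ [n _ <-]; exact: aA.
Qed.

Lemma cseries_cvg (g : nat -> R[i]) a A : (forall n, modulus (g n) <= a n) ->
  (forall n, \sum_(0 <= k < n) a k <= A) ->
  exists l : R[i], series (g : nat -> R[i]^o) n @[n --> \oo] --> (l : R[i]^o).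
Proof.
move=> ga aA.
have abs (h : nat -> R) : (forall n, `|h n| <= a n) -> cvgn (series h).
  move=> ha; apply: normed_cvg; apply: (@bounded_series_cvg _ A) => n.
    exact: normr_ge0.
  by rewrite (le_trans _ (aA n))//; apply: ler_sum => i _; exact: ha.
have /cvg_ex[/= r rP] : cvgn (series (fun n => complex.Re (g n))).
  by apply: abs => n; exact: le_trans (modulus_Re _) (ga n).
have /cvg_ex[/= s sP] : cvgn (series (fun n => complex.Im (g n))).
  by apply: abs => n; exact: le_trans (modulus_Im _) (ga n).
exists (Complex r s); apply: ReIm_cvg.
  by under eq_cvg do rewrite Re_sum.
by under eq_cvg do rewrite Im_sum.
Qed.

(** The remainder of an absolutely convergent series, controlled by what the
    first [n] terms leave of a budget [A] for the majorants [a]. Keeping [A]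
    abstract lets the same statement serve for probability weights, for
    pointwise bounds and for geometric majorants. *)
Lemma cseries_tail (g : nat -> R[i]) a A : (forall n, modulus (g n) <= a n) ->
  (forall n, \sum_(0 <= k < n) a k <= A) -> forall n,
  modulus (limn (series (g : nat -> R[i]^o)) - \sum_(0 <= k < n) g k) <=
  A - \sum_(0 <= k < n) a k.
Proof.
move=> ga aA n; have [l lP] := cseries_cvg ga aA; rewrite (clim_unique lP).
move/ccvgP : lP => lP.
apply/ler_addgt0Pr => e e0.
move/cvgrPdist_lt : lP => /(_ _ e0) [N _ NP].
have /= := NP (maxn n N) (leq_maxr _ _).
rewrite sub0r normrN ger0_norm ?modulus_ge0// modulus_dist => lt.
have -> : l - \sum_(0 <= k < n) g k = l - \sum_(0 <= k < maxn n N) g k +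
    \sum_(n <= k < maxn n N) g k.
  by rewrite (big_cat_nat (n := n) (leq0n _) (leq_maxl n N))/= opprD !addrA subrK.
(* beyond [N] the distance to the limit is below [e]; the terms between [n] and
   [maxn n N] are paid for by the budget *)
rewrite (le_trans (modulusD _ _))// addrC lerD ?(ltW lt)//.
have := aA (maxn n N).
rewrite (big_cat_nat (n := n) (leq0n _) (leq_maxl n N))/= addrC -lerBrDr.
apply: le_trans; rewrite (le_trans (modulus_sum _ _ _))//.
by apply: ler_sum => i _; exact: ga.
Qed.

End complex_limits.

(** * Measurability of complex-valued functions *)

Section complex_measurable.
Context {d : measure_display} {X : measurableType d} {R : realType}.
Implicit Types (f g : X -> R[i]).

Definition cmeasurable f : Prop :=
  measurable_fun setT (fun x => complex.Re (f x)) /\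
  measurable_fun setT (fun x => complex.Im (f x)).

Lemma cmeasurable_cst (c : R[i]) : cmeasurable (fun=> c).
Proof. by split; exact: measurable_cst. Qed.

Lemma cmeasurableD f g : cmeasurable f -> cmeasurable g ->
  cmeasurable (fun x => f x + g x).
Proof.
move=> [f1 f2] [g1 g2]; split.
  by under eq_fun do rewrite ReD; exact: measurable_funD.
by under eq_fun do rewrite ImD; exact: measurable_funD.
Qed.

Lemma cmeasurableM f g : cmeasurable f -> cmeasurable g ->
  cmeasurable (fun x => f x * g x).
Proof.
move=> [f1 f2] [g1 g2]; split.
  under eq_fun do rewrite ReM.
  by apply: measurable_funB; exact: measurable_funM.
under eq_fun do rewrite ImM.
by apply: measurable_funD; exact: measurable_funM.
Qed.

Lemma cmeasurableZ (c : R[i]) f : cmeasurable f -> cmeasurable (fun x => c * f x).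
Proof. by apply: cmeasurableM; exact: cmeasurable_cst. Qed.

Lemma cmeasurableB f g : cmeasurable f -> cmeasurable g ->
  cmeasurable (fun x => f x - g x).
Proof.
move=> mf mg; have := cmeasurableD mf (cmeasurableZ (-1) mg).
by under [in X in X -> _]eq_fun do rewrite mulN1r.
Qed.

Lemma cmeasurable_sum I (s : seq I) (P : pred I) (F : I -> X -> R[i]) :
  (forall i, cmeasurable (F i)) ->
  cmeasurable (fun x => \sum_(i <- s | P i) F i x).
Proof.
move=> mF; elim: s => [|i s IH].
  by under eq_fun do rewrite big_nil; exact: cmeasurable_cst.
under eq_fun do rewrite big_cons.
by case: (P i) => //; exact: cmeasurableD.
Qed.

Lemma measurable_modulus f : cmeasurable f ->
  measurable_fun setT (fun x => modulus (f x)).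
Proof.
move=> [f1 f2]; under eq_fun do rewrite modulusE.
apply: (measurableT_comp (f := @Num.sqrt R)); last first.
  by apply: measurable_funD; exact: measurable_funX.
by apply: continuous_measurable_fun; exact: sqrt_continuous.
Qed.

Lemma cmeasurable_comp (T : X -> X) f : measurable_fun setT T ->
  cmeasurable f -> cmeasurable (f \o T).
Proof.
move=> mT [f1 f2]; split.
  exact: (measurableT_comp (f := fun x => complex.Re (f x))).
exact: (measurableT_comp (f := fun x => complex.Im (f x))).
Qed.

Lemma ccauchy_cvg (u : nat -> R[i]) :
  (forall e : R, 0 < e ->
     exists N, forall n, (N <= n)%N -> modulus (u n - u N) < e) ->
  exists l : R[i], (u : nat -> R[i]^o) n @[n --> \oo] --> (l : R[i]^o).
Proof.
move=> cu.
have real_cvg (v : nat -> R) :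
    (forall m n, `|v m - v n| <= modulus (u m - u n)) -> cvgn v.
  move=> vu; apply: cauchy_cvg; apply: cauchy_exP => e e0.
  have [N NP] := cu _ e0; exists (v N); exists N => // n /= /NP.
  by apply: le_lt_trans; rewrite distrC.
have /cvg_ex[/= a aP] : cvgn (fun n => complex.Re (u n)).
  by apply: real_cvg => m n; rewrite -ReN -ReD modulus_Re.
have /cvg_ex[/= b bP] : cvgn (fun n => complex.Im (u n)).
  by apply: real_cvg => m n; rewrite -ImN -ImD modulus_Im.
by exists (Complex a b); exact: ReIm_cvg.
Qed.

(** Where the sequence diverges, [limn] is the constant default value, so it
    is enough to know that the set of convergence is measurable. *)
Lemma cmeasurable_limn (u : nat -> X -> R[i]) : (forall n, cmeasurable (u n)) ->
  cmeasurable (fun x => limn (fun n => u n x : R[i]^o) : R[i]).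
Proof.
move=> mu.
pose E := [set x | cvgn (fun n => u n x : R[i]^o)].
have EE : E = \bigcap_(k in setT) \bigcup_(N in setT)
    \bigcap_(n in [set n | (N <= n)%N])
    [set x | modulus (u n x - u N x) < k.+1%:R^-1 ].
  apply/seteqP; split => x /= => [/cvg_ex[/= l /ccvgP lP] k _|h].
    have e0 : 0 < k.+1%:R^-1 / 2 :> R by rewrite divr_gt0// invr_gt0.
    move/cvgrPdist_lt : lP => /(_ _ e0)[N _ NP]; exists N => // n /= Nn.
    have := NP n Nn; have := NP N (leqnn N).
    rewrite /= !sub0r !normrN !ger0_norm ?modulus_ge0// => h1 h2.
    rewrite (_ : u n x - u N x = u n x - l - (u N x - l)); last first.
      by rewrite opprB addrA subrK.
    by rewrite (le_lt_trans (modulusB _ _))// [ltRHS]splitr ltrD.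
  have [e e0|l lP] := @ccauchy_cvg (u^~ x); last by apply/cvg_ex; exists l.
  have [k kP] := ltr_add_invr (e0 : 0 < e).
  have [N _ NP] := h k I; exists N => n Nn.
  by rewrite (lt_trans (NP n Nn))// -[ltLHS]add0r.
have mE : measurable E.
  rewrite EE; apply: bigcap_measurableType => k _.
  apply: bigcup_measurable => N _; apply: bigcap_measurableType => n _.
  rewrite -[X in measurable X]setTI.
  have -> : [set x | modulus (u n x - u N x) < k.+1%:R^-1 ] =
      (fun x => modulus (u n x - u N x)) @^-1` `]-oo, k.+1%:R^-1[%classic.
    by apply/seteqP; split=> x /=; rewrite in_itv.
  apply: measurable_modulus => //; exact: cmeasurableB.
rewrite /cmeasurable -(setUv E).
have [p off] : exists p : R[i],
    forall x, (~` E) x -> limn (fun n => u n x : R[i]^o) = p.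
  by exists (point : R[i]^o) => x; exact: dvgP.
split; apply/measurable_funU => //; try exact: measurableC; split.
- apply: (@measurable_fun_cvg _ _ _ _ (fun n x => complex.Re (u n x))).
    by move=> n; apply: (@measurable_funS _ _ _ _ setT) => //; exact: (mu n).1.
  by move=> x Ex; exact: Re_cvg.
- apply: (eq_measurable_fun (fun=> complex.Re p)); last exact: measurable_cst.
  by move=> x /set_mem /off ->.
- apply: (@measurable_fun_cvg _ _ _ _ (fun n x => complex.Im (u n x))).
    by move=> n; apply: (@measurable_funS _ _ _ _ setT) => //; exact: (mu n).2.
  by move=> x Ex; exact: Im_cvg.
- apply: (eq_measurable_fun (fun=> complex.Im p)); last exact: measurable_cst.
  by move=> x /set_mem /off ->.
Qed.

End complex_measurable.

(** * The L2 seminorm and mean-square summation *)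

Section L2norm.
Context {d : measure_display} {X : measurableType d} {R : realType}.
Context (m : probability X R).
Implicit Types (f g : X -> R[i]) (h : X -> R) (A c : R).

Local Notation N2 h := (Lnorm m 2%:E (EFin \o h%R)).
Local Notation sqint f := (\int[m]_x ((modulus (f x)) ^+ 2)%:E)%E.

Lemma sqr_Lnorm h : (N2 h `^ 2)%E = (\int[m]_x ((h x) ^+ 2)%:E)%E.
Proof.
rewrite poweR_Lnorm//; apply: eq_integral => x _.
by rewrite /= powR_mulrn// real_normK// num_real.
Qed.

Lemma Lnorm_leP h A : 0 <= A ->
  (N2 h <= A%:E)%E <-> (\int[m]_x ((h x) ^+ 2)%:E <= (A ^+ 2)%:E)%E.
Proof.
move=> A0; rewrite -sqr_Lnorm; have := Lnorm_ge0 m 2%:E (EFin \o h).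
case: (N2 h) => [r| |]//.
- rewrite !lee_fin => r0; rewrite powR_mulrn//; split=> rA.
    by rewrite lerXn2r// ?nnegrE// (le_trans r0).
  by rewrite -(ler_pXn2r (n := 2))// nnegrE.
- by move=> _; rewrite /= pnatr_eq0/=; split.
Qed.

Lemma Lnorm_sum (h : nat -> X -> R) (a : nat -> R) n :
  (forall k, measurable_fun setT (h k)) -> (forall k, (N2 (h k) <= (a k)%:E)%E) ->
  (N2 (fun x => \sum_(0 <= k < n) h k x) <= (\sum_(0 <= k < n) a k)%:E)%E.
Proof.
move=> mh ha; elim: n => [|n IH].
  rewrite big_geq// Lnorm_leP// expr0n/= integral0_eq// => x _.
  by rewrite big_geq// expr0n.
rewrite big_nat_recr//= EFinD.
rewrite (_ : (fun x => _) =
    (fun x => \sum_(0 <= k < n) h k x) \+ h n)%R; last first.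
  by apply/funext => x; rewrite big_nat_recr.
apply: le_trans (leeD IH (ha n)).
by apply: (@minkowski_EFin _ _ _ m _ _ 2) => //;
  [exact: measurable_sum|rewrite ler1n].
Qed.

(** Minkowski's inequality for countably many functions, by monotone convergence.
    At a point where the sum is infinite the condition on [b] is void, so that
    [b] may come from a pointwise limit with arbitrary default values. *)
Lemma Lnorm_series (h : nat -> X -> R) (a : nat -> R) A (b : X -> R) :
  (forall k, measurable_fun setT (h k)) -> (forall k x, 0 <= h k x) ->
  measurable_fun setT b -> (forall x, 0 <= b x) ->
  (forall k, (N2 (h k) <= (a k)%:E)%E) ->
  (forall n, \sum_(0 <= k < n) a k <= A) ->
  (forall x B, (forall n, \sum_(0 <= k < n) h k x <= B) -> b x <= B) ->
  (N2 b <= A%:E)%E.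
Proof.
move=> mh h0 mb b0 ha aA bB.
have A0 : 0 <= A by have := aA 0%N; rewrite big_geq.
pose F n x := ((\sum_(0 <= k < n) h k x) ^+ 2)%:E.
have F0 n x : (0 <= F n x)%E by rewrite lee_fin sqr_ge0.
have mF n : measurable_fun setT (F n).
  by apply/measurable_EFinP; apply: measurable_funX; exact: measurable_sum.
have ndF x : {homo F ^~ x : p q / (p <= q)%N >-> (p <= q)%E}.
  move=> p q pq; rewrite lee_fin lerXn2r ?nnegrE ?sumr_ge0//.
  by rewrite [leRHS](big_cat_nat (n := p))//= lerDl sumr_ge0.
apply/Lnorm_leP => //.
apply: (@le_trans _ _ (\int[m]_x limn (F ^~ x))%E).
  apply: ge0_le_integral => //.
  - by move=> x _; rewrite lee_fin sqr_ge0.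
  - by apply/measurable_EFinP; exact: measurable_funX.
  - apply: emeasurable_fun_cvg mF _ => x _.
    exact/ereal_nondecreasing_is_cvgn/ndF.
  move=> x _; have Fle n : (F n x <= limn (F ^~ x))%E.
    rewrite (cvg_lim _ (ereal_nondecreasing_cvgn (ndF x)))//.
    by apply: ereal_sup_ubound; exists n.
  have := le_trans (F0 0%N x) (Fle 0%N).
  case: (limn _) Fle => [r| |]// Fle; last by move=> _; rewrite leey.
  rewrite !lee_fin => r0; rewrite -[leRHS]sqr_sqrtr// lerXn2r ?nnegrE ?sqrtr_ge0//.
  apply: bB => n; have := Fle n; rewrite lee_fin => /ler_wsqrtr.
  by rewrite sqrtr_sqr ger0_norm// sumr_ge0.
have cF := @cvg_monotone_convergence _ _ _ m _ measurableT F mF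
  (fun n x _ => F0 n x) (fun x _ => ndF x).
rewrite -(cvg_lim _ cF)//; apply: lime_le.
  by apply/cvg_ex; eexists; exact: cF.
apply: nearW => n; apply/(Lnorm_leP _ A0).
by apply: (le_trans (Lnorm_sum n mh ha)); rewrite lee_fin.
Qed.

(** The norm as a real number; [L2norm_fin] recovers the extended one on square
    integrable functions. *)
Definition nrm f : R := fine (L2norm m f).

Lemma nrm_ge0 f : 0 <= nrm f.
Proof. by rewrite /nrm fine_ge0// Lnorm_ge0. Qed.

Lemma in_L2_measurable f : in_L2 m f -> cmeasurable f.
Proof. by case. Qed.

Lemma L2norm_fin f : in_L2 m f -> L2norm m f = (nrm f)%:E.
Proof. by case=> _ _ fy; rewrite /nrm fineK// ge0_fin_numE// Lnorm_ge0. Qed.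

Lemma in_L2_bound f A : cmeasurable f -> (L2norm m f <= A%:E)%E ->
  in_L2 m f /\ nrm f <= A.
Proof.
move=> [f1 f2] fA.
have fL : in_L2 m f by split=> //; rewrite (le_lt_trans fA)// ltry.
by split=> //; rewrite -lee_fin -L2norm_fin.
Qed.

Lemma in_L2_sqint_bound f A : cmeasurable f -> 0 <= A ->
  (sqint f <= (A ^+ 2)%:E)%E -> in_L2 m f /\ nrm f <= A.
Proof. by move=> mf A0 fA; apply: in_L2_bound => //; apply/Lnorm_leP. Qed.

Lemma sqint_nrm f : in_L2 m f -> sqint f = ((nrm f) ^+ 2)%:E.
Proof.
move=> /L2norm_fin; rewrite -sqr_Lnorm /L2norm /comp => ->.
by rewrite poweR_EFin powR_mulrn// nrm_ge0.
Qed.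

Lemma in_L2_sqint_eq f A : cmeasurable f -> 0 <= A ->
  sqint f = (A ^+ 2)%:E -> in_L2 m f /\ nrm f = A.
Proof.
move=> mf A0 E; have [|fL _] := in_L2_sqint_bound mf A0; first by rewrite E.
split=> //; apply: (pexpIrn (n := 2)) => //; rewrite ?nnegrE ?nrm_ge0//.
by apply: EFin_inj; rewrite -sqint_nrm.
Qed.

Lemma measurable_sqmod f : cmeasurable f ->
  measurable_fun setT (fun x => ((modulus (f x)) ^+ 2)%:E).
Proof.
by move=> mf; apply/measurable_EFinP/measurable_funX; exact: measurable_modulus.
Qed.

Lemma in_L2Z_nrm (c : R[i]) f : in_L2 m f ->
  in_L2 m (fun x => c * f x) /\ nrm (fun x => c * f x) = modulus c * nrm f.
Proof.
move=> fL; have mf := in_L2_measurable fL.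
apply: in_L2_sqint_eq; first exact: cmeasurableZ.
  by rewrite mulr_ge0 ?modulus_ge0 ?nrm_ge0.
rewrite exprMn EFinM -sqint_nrm// -ge0_integralZl_EFin ?sqr_ge0//.
- by apply: eq_integral => x _; rewrite modulusM exprMn EFinM.
- by move=> x _; rewrite lee_fin sqr_ge0.
- exact: measurable_sqmod.
Qed.

Lemma in_L2D_nrm f g : in_L2 m f -> in_L2 m g ->
  in_L2 m (fun x => f x + g x) /\ nrm (fun x => f x + g x) <= nrm f + nrm g.
Proof.
move=> fL gL; have [mf mg] := (in_L2_measurable fL, in_L2_measurable gL).
have mfg := cmeasurableD mf mg.
apply: in_L2_bound => //; rewrite EFinD -!L2norm_fin//.
apply: le_trans (@minkowski_EFin _ _ _ m (fun x => modulus (f x))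
  (fun x => modulus (g x)) 2 _ _ _); last first.
- by rewrite ler1n.
- exact: measurable_modulus.
- exact: measurable_modulus.
rewrite /L2norm unlock /=; apply: gt0_ler_poweR; rewrite ?invr_ge0//.
- by rewrite in_itv/= leey andbT; apply: integral_ge0 => x _;
    rewrite lee_fin powR_ge0.
- by rewrite in_itv/= leey andbT; apply: integral_ge0 => x _;
    rewrite lee_fin powR_ge0.
have sqE (h : X -> R) : (forall x, 0 <= h x) ->
    (\int[m]_x (`|h x| `^ 2)%:E)%E = (\int[m]_x ((h x) ^+ 2)%:E)%E.
  move=> h0; apply: eq_integral => x _.
  by rewrite /= powR_mulrn// real_normK// num_real.
rewrite !sqE//=; last 2 first.
  by move=> x; rewrite addr_ge0 ?modulus_ge0.
  by move=> x; rewrite modulus_ge0.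
apply: ge0_le_integral => //.
- by move=> x _; rewrite lee_fin sqr_ge0.
- exact: measurable_sqmod.
- apply/measurable_EFinP/measurable_funX/measurable_funD; exact: measurable_modulus.
- move=> x _; rewrite lee_fin lerXn2r ?nnegrE ?modulus_ge0 ?modulusD//.
  by rewrite addr_ge0 ?modulus_ge0.
Qed.

Lemma nrm_parallelogram f g : in_L2 m f -> in_L2 m g ->
  nrm (fun x => f x + g x) ^+ 2 + nrm (fun x => f x - g x) ^+ 2 =
  2 * nrm f ^+ 2 + 2 * nrm g ^+ 2.
Proof.
move=> fL gL; have [mf mg] := (in_L2_measurable fL, in_L2_measurable gL).
have [DL _] := in_L2D_nrm fL gL.
have BE : (fun x => f x - g x) = (fun x => f x + -1 * g x).
  by apply/funext => x; rewrite mulN1r.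
have BL : in_L2 m (fun x => f x - g x).
  by rewrite BE; apply: (in_L2D_nrm fL _).1; exact: (in_L2Z_nrm _ _).1.
apply: EFin_inj; rewrite !EFinD !(EFinM 2) -!sqint_nrm//.
rewrite -!ge0_integralZl_EFin//; try by move=> x _; rewrite lee_fin sqr_ge0.
- rewrite -!ge0_integralD//.
  + by apply: eq_integral => x _; rewrite -!EFinM -!EFinD modulus_parallelogram.
  + by move=> x _; rewrite -EFinM lee_fin mulr_ge0 ?sqr_ge0.
  + by apply: measurable_funeM; exact: measurable_sqmod.
  + by move=> x _; rewrite -EFinM lee_fin mulr_ge0 ?sqr_ge0.
  + by apply: measurable_funeM; exact: measurable_sqmod.
  + by move=> x _; rewrite lee_fin sqr_ge0.
  + by apply: measurable_sqmod; exact: in_L2_measurable.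
  + by move=> x _; rewrite lee_fin sqr_ge0.
  + by apply: measurable_sqmod; exact: in_L2_measurable.
- exact: measurable_sqmod.
- exact: measurable_sqmod.
Qed.

(** The pointwise sum, with whatever default value it takes where it diverges,
    is a sum in the mean-square sense.  Both the completeness of the space and
    the averages along orbits rest on this. *)
Lemma L2_series_limn (g : nat -> X -> R[i]) (a : nat -> R) A :
  (forall k, in_L2 m (g k)) -> (forall k, nrm (g k) <= a k) ->
  (forall n, \sum_(0 <= k < n) a k <= A) ->
  let s x := limn (series (fun k => g k x : R[i]^o)) : R[i] in
  in_L2 m s /\
  forall n, nrm (fun x => s x - \sum_(0 <= k < n) g k x) <=
            A - \sum_(0 <= k < n) a k.
Proof.
move=> gL ga aA s.
have mg k : cmeasurable (g k) by exact: in_L2_measurable.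
have ms : cmeasurable s.
  apply: (@cmeasurable_limn _ _ _ (fun n x => \sum_(0 <= k < n) g k x)) => n.
  exact: cmeasurable_sum.
have main n : in_L2 m (fun x => s x - \sum_(0 <= k < n) g k x) /\
    nrm (fun x => s x - \sum_(0 <= k < n) g k x) <= A - \sum_(0 <= k < n) a k.
  have mt : cmeasurable (fun x => s x - \sum_(0 <= k < n) g k x).
    by apply: cmeasurableB => //; exact: cmeasurable_sum.
  apply: in_L2_bound => //.
  apply: (@Lnorm_series (fun k x => modulus (g (n + k)%N x))
    (fun k => a (n + k)%N)).
  - by move=> k; exact: measurable_modulus.
  - by move=> k x; exact: modulus_ge0.
  - exact: measurable_modulus.
  - by move=> x; exact: modulus_ge0.
  - move=> k; have := L2norm_fin (gL (n + k)%N); rewrite /L2norm => ->.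
    by rewrite lee_fin.
  - move=> p; rewrite lerBrDl; apply: le_trans (aA (n + p)%N).
    rewrite [leRHS](big_cat_nat (n := n)) ?leq_addr//= lerD2l.
    by rewrite -{2}[n]add0n big_addn addKn; under [leRHS]eq_bigr do rewrite addnC.
  (* a bound [B] on the tail sums at [x] makes the series converge at [x] *)
  - move=> x B Bh.
    have := @cseries_tail _ (g ^~ x) (fun k => modulus (g k x))
      (\sum_(0 <= k < n) modulus (g k x) + B) (fun=> lexx _).
    rewrite /s => /(_ _ n); rewrite addrAC subrr add0r; apply => p.
    have [pn|np] := leqP p n.
      rewrite (big_cat_nat (n := p) _ pn)//= -addrA lerDl addr_ge0//.
        by rewrite sumr_ge0// => i _; exact: modulus_ge0.
      by have := Bh 0%N; rewrite big_geq.
    rewrite (big_cat_nat (n := n) _ (ltnW np))//= lerD2l.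
    rewrite -{1}[n]add0n big_addn; under eq_bigr do rewrite addnC.
    exact: Bh.
split; last by move=> n; exact: (main n).2.
have := (main 0%N).1; under [X in in_L2 m X]eq_fun do rewrite big_geq// subr0.
by [].
Qed.

End L2norm.

(** * Series in complete seminormed spaces *)

Section seminormed_spaces.
Context {R : realType}.

(** Square-integrable functions are not identified when they agree almost
    everywhere, and [N] is meaningful on [P] only, so this is a seminorm on a
    subspace.  Completeness is expressed by the convergence of series with
    summable norms, again with a budget [A] for the remainders. *)
Record complete_seminorm (V : lmodType R[i]) (P : V -> Prop) (N : V -> R) : Prop :=
  CompleteSeminorm {
  sn_0 : P 0;
  sn_D : forall f g, P f -> P g -> P (f + g);
  sn_Z : forall c f, P f -> P (c *: f);
  sn_ge0 : forall f, 0 <= N f;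
  sn_normD : forall f g, P f -> P g -> N (f + g) <= N f + N g;
  sn_normZ : forall c f, P f -> N (c *: f) = modulus c * N f;
  sn_series : forall (g : nat -> V) (a : nat -> R) (A : R),
    (forall k, P (g k)) -> (forall k, N (g k) <= a k) ->
    (forall n, \sum_(0 <= k < n) a k <= A) ->
    exists s, P s /\ forall n,
      N (s - \sum_(0 <= k < n) g k) <= A - \sum_(0 <= k < n) a k }.

Context {V : lmodType R[i]} {P : V -> Prop} {N : V -> R}.
Context (HN : complete_seminorm P N).
Implicit Types (f g : V) (c : R[i]).

Lemma sn_N f : P f -> P (- f).
Proof. by move=> Pf; rewrite -scaleN1r; exact: (sn_Z HN). Qed.

Lemma sn_B f g : P f -> P g -> P (f - g).
Proof. by move=> Pf Pg; apply: (sn_D HN) => //; exact: sn_N. Qed.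

Lemma sn_sum I (s : seq I) (Q : pred I) (F : I -> V) :
  (forall i, P (F i)) -> P (\sum_(i <- s | Q i) F i).
Proof. by move=> PF; elim/big_ind : _ => //; [exact: sn_0 HN|exact: sn_D HN]. Qed.

Lemma sn_normN f : P f -> N (- f) = N f.
Proof. by move=> Pf; rewrite -scaleN1r (sn_normZ HN)// modulusN modulus1 mul1r. Qed.

Lemma sn_normB f g : P f -> P g -> N (f - g) <= N f + N g.
Proof.
by move=> Pf Pg; rewrite -(sn_normN Pg); apply: (sn_normD HN) => //; exact: sn_N.
Qed.

Lemma sn_norm0 : N 0 = 0.
Proof.
by rewrite -(scale0r (0 : V)) (sn_normZ HN) ?modulus0 ?mul0r//; exact: sn_0 HN.
Qed.

Lemma sn_norm_sum I (s : seq I) (Q : pred I) (F : I -> V) :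
  (forall i, P (F i)) -> N (\sum_(i <- s | Q i) F i) <= \sum_(i <- s | Q i) N (F i).
Proof.
move=> PF; suff [] : P (\sum_(i <- s | Q i) F i) /\
  N (\sum_(i <- s | Q i) F i) <= \sum_(i <- s | Q i) N (F i) by [].
elim/big_rec2 : _ => [|i x y _ [Px xy]].
  by rewrite sn_norm0; split=> //; exact: sn_0 HN.
split; first exact: (sn_D HN).
by rewrite (le_trans (sn_normD HN _ _))// lerD2l.
Qed.

Definition sn_cauchy (f : nat -> V) : Prop := forall e : R, 0 < e ->
  exists M, forall p q, (M <= p <= q)%N -> N (\sum_(p <= k < q) f k) <= e.

Lemma sn_cauchy_cvg (f : nat -> V) : (forall k, P (f k)) -> sn_cauchy f ->
  exists s, P s /\ N (\sum_(0 <= k < n) f k - s) @[n --> \oo] --> (0 : R).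
Proof.
move=> Pf cf.
(* sum in blocks that begin at [c j], beyond which sums are below [2 ^- j] *)
pose e (j : nat) : R := 2^-1 ^+ j.
have e0 j : 0 < e j by rewrite exprn_gt0// invr_gt0.
have /choice[M MP] : forall j, exists M, forall p q, (M <= p <= q)%N ->
    N (\sum_(p <= k < q) f k) <= e j by move=> j; exact: cf.
pose c := fix c j := if j is i.+1 then maxn (c i) (M j) else M 0%N.
have cM j : (M j <= c j)%N by case: j => [|j]//=; rewrite leq_maxr.
have cc j : (c j <= c j.+1)%N by rewrite /= leq_maxl.
have c0 j : (c 0%N <= c j)%N by elim: j => // j IH; exact: leq_trans IH (cc j).
have Pfs p q : P (\sum_(p <= k < q) f k) by exact: sn_sum.
have eE n : \sum_(0 <= k < n) e k = 2 - 2 * e n.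
  elim: n => [|n IH]; first by rewrite big_geq// /e expr0 mulr1 subrr.
  by rewrite big_nat_recr//= IH /e exprS; field.
have [|j|n|s [Ps sP]] := @sn_series _ _ _ HN
    (fun j => \sum_(c j <= k < c j.+1) f k) e 2.
- by move=> k; exact: Pfs.
- by apply: MP; rewrite cM cc.
- by rewrite eE gerBl// mulr_ge0// ltW.
exists (\sum_(0 <= k < c 0%N) f k + s); split; first exact: (sn_D HN).
have blocks j : \sum_(0 <= i < j) \sum_(c i <= k < c i.+1) f k =
    \sum_(c 0%N <= k < c j) f k.
  elim: j => [|j IH]; first by rewrite !big_geq.
  by rewrite big_nat_recr//= IH [in RHS](big_cat_nat (n := c j))// leq_maxl.
have tail j :
    N (\sum_(0 <= k < c j) f k - (\sum_(0 <= k < c 0%N) f k + s)) <= 2 * e j.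
  rewrite (big_cat_nat (n := c 0%N))//= opprD addrACA subrr add0r.
  rewrite -sn_normN; last by apply: sn_B => //; exact: Pfs.
  have := sP j; rewrite blocks eE (opprB 2) (addrC 2) subrK => sPj.
  by rewrite opprB; exact: sPj.
apply/cvgrPdist_le => r r0.
have [j jP] : exists j, 3 * e j <= r.
  have /cvgrPdist_le/(_ (r / 3)) : e n @[n --> \oo] --> (0 : R).
    by apply: cvg_expr; rewrite ger0_norm ?invr_ge0// invf_lt1// ltr1n.
  rewrite divr_gt0// => /(_ isT)[j _ /(_ j (leqnn j))] /=.
  rewrite sub0r normrN (gtr0_norm (e0 j)) ler_pdivlMr// mulrC => le.
  by exists j.
exists (c j) => // n /= jn.
rewrite sub0r normrN ger0_norm ?(sn_ge0 HN)// (le_trans _ jP)//.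
rewrite (big_cat_nat (n := c j))//= addrAC (natrD _ 2 1) mulrDl mul1r.
rewrite (le_trans (sn_normD HN _ _))//.
- by apply: sn_B; [exact: Pfs|apply: (sn_D HN) => //; exact: Pfs].
- by apply: lerD; [exact: tail|rewrite MP// cM].
Qed.

(** In a Hilbert space a series whose signed partial sums are bounded
    is Cauchy: otherwise blocks [g_j] of norm more than [e] recur for ever, and
    the parallelogram law lets one choose the signs one after the other so that
    the squared norm of the signed sum is at least the sum of the squares. *)
Lemma bounded_signs_cauchy (f : nat -> V) (C : R) : (forall k, P (f k)) ->
  (forall f g, P f -> P g ->
    N (f + g) ^+ 2 + N (f - g) ^+ 2 = 2 * N f ^+ 2 + 2 * N g ^+ 2) ->
  (forall n (e : nat -> R[i]), (forall k, modulus (e k) <= 1) ->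
    N (\sum_(0 <= k < n) e k *: f k) <= C) ->
  sn_cauchy f.
Proof.
move=> Pf plaw fC.
have Pef (e : nat -> R[i]) p q : P (\sum_(p <= k < q) e k *: f k).
  by apply: sn_sum => k; exact: (sn_Z HN).
suff weak (e : R) : 0 < e ->
    exists M, forall n, (M <= n)%N -> N (\sum_(M <= k < n) f k) <= e.
  move=> e e0; have [M MP] := weak (e / 2) (divr_gt0 e0 (ltr0Sn _ 1)).
  exists M => p q /andP[Mp pq].
  have -> : \sum_(p <= k < q) f k = \sum_(M <= k < q) f k - \sum_(M <= k < p) f k.
    by rewrite [X in _ = X - _](big_cat_nat (n := p))//= addrAC subrr add0r.
  rewrite (le_trans (sn_normB _ _))//; try exact: sn_sum.
  by rewrite [leRHS]splitr lerD// MP// (leq_trans Mp).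
move=> e0; apply: contrapT => /forallNP h.
have /choice[q qP] : forall M, exists n,
    (M <= n)%N /\ e < N (\sum_(M <= k < n) f k).
  move=> M; have /existsNP[n /not_implyP[Mn /negP]] := h M.
  by rewrite -ltNge; exists n.
pose b j := iter j q 0%N.
have grow J : exists s : nat -> R[i], (forall k, modulus (s k) <= 1) /\
    J%:R * e ^+ 2 <= N (\sum_(0 <= k < b J) s k *: f k) ^+ 2.
  elim: J => [|J [s [s1 sJ]]].
    by exists (fun=> 0); split; rewrite ?modulus0// mul0r sqr_ge0.
  set S := \sum_(_ <= _ < _) _ in sJ.
  pose g := \sum_(b J <= k < b J.+1) f k.
  have [bq eg] := qP (b J).
  have PS : P S by exact: Pef.
  have Pg : P g by exact: sn_sum.
  have [t [t1 tg]] : exists t : R[i], modulus t <= 1 /\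
      N S ^+ 2 + N g ^+ 2 <= N (S + t *: g) ^+ 2.
    have := plaw _ _ PS Pg.
    have [le _|lt E] := leP (N S ^+ 2 + N g ^+ 2) (N (S + g) ^+ 2).
      by exists 1; rewrite modulus1 scale1r.
    exists (-1); rewrite modulusN modulus1 scaleN1r; split=> //; lra.
  exists (fun k => if (k < b J)%N then s k else t); split.
    by move=> k; case: ifP.
  rewrite (big_cat_nat (n := b J))//=.
  rewrite (_ : \sum_(0 <= i < b J) _ = S); last first.
    by apply: eq_big_nat => k /andP[_ ->].
  rewrite (_ : \sum_(b J <= i < q (b J)) _ = t *: g); last first.
    by rewrite scaler_sumr; apply: eq_big_nat => k /andP[bk _]; rewrite ltnNge bk.
  apply: le_trans tg; rewrite -natr1 mulrDl mul1r lerD//.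
  by rewrite lerXn2r ?nnegrE ?(sn_ge0 HN)// ltW.
have := Num.Theory.archi_boundP (divr_ge0 (sqr_ge0 C) (sqr_ge0 e)).
set J := Num.bound _; rewrite ltr_pdivrMr ?exprn_gt0// => CJ.
have [s [s1]] := grow J; apply/negP; rewrite -ltNge (le_lt_trans _ CJ)//.
have C0 : 0 <= C by exact: le_trans (sn_ge0 HN _) (fC 0%N s s1).
by rewrite lerXn2r ?nnegrE ?(sn_ge0 HN)// fC.
Qed.

End seminormed_spaces.

(** * Uniform boundedness and unconditional convergence *)

Section uniform_boundedness.
Context {R : realType} {V : lmodType R[i]} {P : V -> Prop} {N : V -> R}.
Context (HN : complete_seminorm P N).
Context {I : Type} {Phi : I -> V -> R} {B : I -> R}.
Context (PhiD : forall i f g, P f -> P g -> Phi i (f + g) <= Phi i f + Phi i g).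
Context (PhiZ : forall i c f, P f -> Phi i (c *: f) = modulus c * Phi i f).
Context (PhiB : forall i f, P f -> Phi i f <= B i * N f).

Let PhiN i f : P f -> Phi i (- f) = Phi i f.
Proof. by move=> Pf; rewrite -scaleN1r PhiZ// modulusN modulus1 mul1r. Qed.

(** A gliding hump argument: if no uniform bound existed, arbitrarily
    small perturbations would make some [Phi i] arbitrarily large, since
    [Phi i y] is at most the larger of [Phi i (x + y)] and [Phi i (x - y)].
    Adding such perturbations one after the other, each so small that it
    spoils the previous gains by at most 1, gives a point at which the family
    is unbounded. *)
Lemma uniform_boundedness :
  (forall f, P f -> exists C, forall i, Phi i f <= C) ->
  exists C, forall i f, P f -> Phi i f <= C * N f.
Proof.
move=> bdd; apply: contrapT => /forallNP unb.
have large (r : R) (n : nat) : 0 < r ->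
    exists i y, [/\ P y, N y <= r & n%:R < Phi i y].
  move=> r0; have n0 : 0 < n.+1%:R :> R by [].
  have /existsNP[i /existsNP[f /not_implyP[Pf /negP]]] := unb (n.+1%:R / r).
  rewrite -ltNge => big.
  have Phi0 : 0 < Phi i f.
    by apply: le_lt_trans big; rewrite mulr_ge0 ?(sn_ge0 HN)// divr_ge0// ltW.
  exists i, ((n.+1%:R / Phi i f)%:C%C *: f); split; first exact: (sn_Z HN).
    rewrite (sn_normZ HN)// modulus_real ?divr_ge0 ?(ltW Phi0)//.
    rewrite mulrAC ltr_pdivrMr// in big.
    by rewrite mulrAC ler_pdivrMr// (mulrC r) ltW.
  rewrite PhiZ// modulus_real ?divr_ge0 ?(ltW Phi0)//.
  by rewrite divfK ?gt_eqF// ltr_nat.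
have perturb (x : V) (r : R) (n : nat) : exists zi : V * I, P x -> 0 < r ->
    [/\ P zi.1, N zi.1 <= r & n%:R < Phi zi.2 (x + zi.1)].
  have [[Px r0]|no] := pselect (P x /\ 0 < r); last first.
    have [i _] := large 1 n ltr01.
    by exists (0, i) => Px r0; exfalso; apply: no.
  have [i [y [Py yr yn]]] := large r n r0.
  have [lt|le] := ltP n%:R (Phi i (x + y)); first by exists (y, i).
  exists (- y, i) => _ _ /=; split; [exact: (sn_N HN)|by rewrite (sn_normN HN)|].
  have := PhiD i (sn_D HN Px Py) (sn_N HN (sn_B HN Px Py)).
  have -> : x + y + - (x - y) = (2%:R)%:C%C *: y.
    rewrite opprB addrC addrA subrK -mulr2n.
    by rewrite -scaler_nat rmorph_nat.
  rewrite PhiN ?PhiZ ?modulus_real//; last exact: (sn_B HN).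
  by move: yn le; lra.
have /choice[F FP] : forall xrn : V * R * nat, exists zi : V * I,
    P xrn.1.1 -> 0 < xrn.1.2 ->
    [/\ P zi.1, N zi.1 <= xrn.1.2 & xrn.2%:R < Phi zi.2 (xrn.1.1 + zi.1)].
  by move=> [[x r] n]; exact: perturb.
(* halving keeps all later perturbations together within [2 * r]; the other bound
   makes their effect on [Phi i] at most 1 *)
pose shrink (r : R) i := Num.min (r / 2) (2 * (1 + `|B i|))^-1.
pose st := fix st n : V * R := if n is n'.+1 then
  let zi := F (st n', n') in ((st n').1 + zi.1, shrink (st n').2 zi.2) else (0, 1).
pose x n := (st n).1; pose r n := (st n).2.
pose z n := (F (st n, n)).1; pose i n := (F (st n, n)).2.
have Pxr n : P (x n) /\ 0 < r n.
  elim: n => [|n [Px rn]]; first by split; [exact: sn_0 HN|].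
  have [Pz _ _] := FP (st n, n) Px rn.
  split; first exact: (sn_D HN).
  by rewrite /r /= /shrink lt_min divr_gt0//= invr_gt0 mulr_gt0// ltr_wpDr.
have zP n : [/\ P (z n), N (z n) <= r n & n%:R < Phi (i n) (x n.+1)].
  by have [Px rn] := Pxr n; have := FP (st n, n) Px rn.
have xE n : x n = \sum_(0 <= k < n) z k.
  by elim: n => [|n IH]; [rewrite big_geq|rewrite big_nat_recr//= -IH].
have rr n : r n.+1 <= r n / 2 by rewrite /r /= /shrink ge_min lexx.
have rB n : `|B (i n)| * (2 * r n.+1) <= 1.
  have D0 : 0 < 2 * (1 + `|B (i n)|) by rewrite mulr_gt0// ltr_wpDr.
  have : r n.+1 <= (2 * (1 + `|B (i n)|))^-1.
    by rewrite /r /= /shrink ge_min lexx orbT.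
  rewrite -[leRHS]mul1r ler_pdivlMr//; have := (Pxr n.+1).2; nra.
(* [r n] is at most [2 * r n - 2 * r n.+1], a majorant whose sums telescope *)
have aE n : \sum_(0 <= k < n) (2 * r k - 2 * r k.+1) = 2 * r 0%N - 2 * r n.
  elim: n => [|n IH]; first by rewrite big_geq// subrr.
  by rewrite big_nat_recr//= IH; lra.
have [||n|y [Py yP]] := @sn_series _ _ _ _ HN z
    (fun k => 2 * r k - 2 * r k.+1) (2 * r 0%N).
- by move=> k; have [] := zP k.
- by move=> k; have [_ le _] := zP k; rewrite (le_trans le)//; have := rr k; lra.
- by rewrite aE gerBl mulr_ge0// ltW// (Pxr n).2.
have [C CP] := bdd y Py.
have := archi_boundP (normr_ge0 (C + 1)); set n := Num.bound _ => Cn.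
have [_ _ big] := zP n; have := yP n.+1.
rewrite aE -xE (opprB (2 * _)) (addrC (2 * r 0%N)) subrK => near.
have Px := (Pxr n.+1).1.
have : Phi (i n) (x n.+1) <= Phi (i n) y + `|B (i n)| * (2 * r n.+1).
  rewrite -{1}(subrK y (x n.+1)) addrC (le_trans (PhiD _ Py (sn_B HN Px Py)))//.
  rewrite lerD2l (le_trans (PhiB _ (sn_B HN Px Py)))//.
  apply: (@le_trans _ _ (`|B (i n)| * N (x n.+1 - y))).
    by rewrite ler_wpM2r ?(sn_ge0 HN)// ler_norm.
  by rewrite ler_wpM2l// -(sn_normN HN) ?opprB//; exact: (sn_B HN).
have := CP (i n); have := rB n; have := ler_norm (C + 1); lra.
Qed.

End uniform_boundedness.

Section unconditional.

(** Listing, inside every interval cut out by [b], the elements of [Q j] before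
    the others gives a permutation of the natural numbers. *)
Lemma block_permutation (b : nat -> nat) (Q : nat -> pred nat) :
  b 0%N = 0%N -> (forall j, b j < b j.+1)%N ->
  exists pi : nat -> nat, bijective pi /\ forall j,
    [seq pi k |
      k <- iota (b j) (size [seq k <- index_iota (b j) (b j.+1) | Q j k])] =
    [seq k <- index_iota (b j) (b j.+1) | Q j k].
Proof.
move=> b0 bS.
pose I j := index_iota (b j) (b j.+1).
(* [L n] lists the first [n] rearranged intervals; it is a prefix of [L n.+1] *)
pose l j := [seq k <- I j | Q j k] ++ [seq k <- I j | ~~ Q j k].
pose L n := flatten [seq l j | j <- iota 0 n].
have LS n : L n.+1 = L n ++ l n.
  by rewrite /L -addn1 iotaD map_cat flatten_cat/= cats0.
have Lperm n : perm_eq (L n) (index_iota 0 (b n)).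
  elim: n => [|n IH]; first by rewrite b0.
  rewrite LS /index_iota subn0 -(subnKC (ltnW (bS n))) iotaD add0n.
  apply: perm_cat; first by move: IH; rewrite /index_iota subn0.
  by rewrite /l perm_filterC.
have sL n : size (L n) = b n by rewrite (perm_size (Lperm n)) size_iota subn0.
have bn n : (n <= b n)%N by elim: n => // n IH; exact: leq_ltn_trans IH (bS n).
have Lpre n p : (n <= p)%N -> exists t, L p = L n ++ t.
  elim: p => [|p IH]; first by rewrite leqn0 => /eqP ->; exists [::]; rewrite cats0.
  rewrite leq_eqVlt => /predU1P[->|/IH[t tP]]; first by exists [::]; rewrite cats0.
  by exists (t ++ l p); rewrite LS tP catA.
have nthL n p k : (k < b n)%N -> (n <= p)%N -> nth 0%N (L p) k = nth 0%N (L n) k.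
  by move=> kn /Lpre[t ->]; rewrite nth_cat sL kn.
have idxL n p v : v \in L n -> (n <= p)%N -> index v (L p) = index v (L n).
  by move=> vn /Lpre[t ->]; rewrite index_cat vn.
have Lu n : uniq (L n) by rewrite (perm_uniq (Lperm n)) iota_uniq.
have Lin n v : (v \in L n) = (v < b n)%N.
  by rewrite (perm_mem (Lperm n)) mem_index_iota.
pose pi k := nth 0%N (L k.+1) k.
have piE n k : (k < b n)%N -> pi k = nth 0%N (L n) k.
  move=> kn; rewrite /pi; have [le|/ltnW le] := leqP n k.+1; first exact: nthL.
  by rewrite -(nthL _ _ _ (bn k.+1) le).
exists pi; split.
  exists (fun v => index v (L v.+1)) => [k|v].
    set p := maxn k.+1 (pi k).+1.
    have kp : (k < b p)%N by rewrite (leq_trans _ (bn p))// leq_maxl.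
    rewrite -(@idxL _ p) ?leq_maxr//; last by rewrite Lin bn.
    by rewrite (piE p)// index_uniq// sL.
  set k := index _ _.
  have kb : (k < b v.+1)%N by rewrite -sL index_mem Lin bn.
  by rewrite (piE v.+1)// nth_index// Lin bn.
move=> j; set F := [seq k <- _ | _].
apply: (@eq_from_nth _ 0%N) => [|t]; rewrite size_map size_iota// => tF.
rewrite (nth_map 0%N) ?size_iota// nth_iota//.
have sF : (size F <= b j.+1 - b j)%N.
  by rewrite size_filter (leq_trans (count_size _ _))// size_iota.
rewrite (piE j.+1); last by rewrite -ltn_subRL (leq_trans tF).
by rewrite LS nth_cat sL ltnNge leq_addr/= addKn nth_cat tF.
Qed.

Context {R : realType} {V : lmodType R[i]} {P : V -> Prop} {N : V -> R}.
Context (HN : complete_seminorm P N).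

(** If the sums over finite sets of indices were unbounded, there would be
    sets [Q j] of indices, one inside each of successive intervals, over which
    the sum has norm more than 1; a rearrangement that lists [Q j] without
    interruption is not Cauchy. *)
Lemma unconditional_bounded (f : nat -> V) : (forall k, P (f k)) ->
  (forall pi : nat -> nat, bijective pi ->
    exists s, P s /\ N (\sum_(0 <= k < n) f (pi k) - s) @[n --> \oo] --> (0 : R)) ->
  exists C, forall n (Q : pred nat), N (\sum_(0 <= k < n | Q k) f k) <= C.
Proof.
move=> Pf cvf.
suff [M MP] : exists M, forall n (Q : pred nat), (M <= n)%N ->
    N (\sum_(M <= k < n | Q k) f k) <= 1.
  exists (\sum_(0 <= k < M) N (f k) + 1) => n Q.
  have head p : (p <= M)%N ->
      N (\sum_(0 <= k < p | Q k) f k) <= \sum_(0 <= k < M) N (f k).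
    move=> pM; rewrite (le_trans (sn_norm_sum HN _ _ _))//.
    rewrite [leRHS](big_cat_nat (n := p))//= big_mkcond/=.
    apply: ler_wpDr; first by apply: sumr_ge0 => k _; exact: (sn_ge0 HN).
    by apply: ler_sum => k _; case: ifP => // _; exact: (sn_ge0 HN).
  have [nM|Mn] := leqP n M.
    by rewrite (le_trans (head n nM))// lerDl.
  rewrite (big_cat_nat (n := M))//= ?(ltnW Mn)//.
  by rewrite (le_trans (sn_normD HN _ _)) ?lerD ?head ?MP ?(ltnW Mn)//;
    exact: (sn_sum HN).
apply: contrapT => /forallNP unb.
have /choice[nQ nQP] : forall M, exists nQ : nat * pred nat,
    (M <= nQ.1)%N /\ 1 < N (\sum_(M <= k < nQ.1 | nQ.2 k) f k).
  move=> M; have /existsNP[n /existsNP[Q /not_implyP[Mn /negP]]] := unb M.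
  by rewrite -ltNge; exists (n, Q).
pose b j := iter j (fun M => (nQ M).1) 0%N.
have bS j : (b j < b j.+1)%N.
  have [le lt] := nQP (b j); rewrite ltn_neqAle le andbT.
  apply/eqP => /= E; move: lt; rewrite -E big_geq// (sn_norm0 HN).
  by rewrite ltr10.
have [pi [pib piP]] := @block_permutation b (fun j => (nQ (b j)).2) erefl bS.
have [s [Ps /cvgrPdist_lt/(_ 2^-1)]] := cvf _ pib.
rewrite invr_gt0 ltr0n => /(_ isT)[M _ MP].
have bM : (M <= b M)%N by elim: {MP} M => // M IH; exact: leq_ltn_trans IH (bS M).
have [_] := nQP (b M); apply/negP; rewrite -leNgt.
set c := size [seq k <- index_iota (b M) (b M.+1) | (nQ (b M)).2 k].
have -> : \sum_(b M <= k < (nQ (b M)).1 | (nQ (b M)).2 k) f k =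
    \sum_(0 <= k < b M + c) f (pi k) - \sum_(0 <= k < b M) f (pi k).
  rewrite [X in _ = X - _](big_cat_nat (n := b M)) ?leq_addr//=.
  rewrite addrAC subrr add0r.
  by rewrite -big_filter -(piP M) big_map /index_iota addKn.
rewrite -(subrKA s) (_ : s - _ = - (\sum_(0 <= k < b M) f (pi k) - s)); last first.
  by rewrite opprB.
have Pd n : P (\sum_(0 <= k < n) f (pi k) - s).
  by apply: (sn_B HN) => //; exact: (sn_sum HN).
rewrite (le_trans (sn_normB HN (Pd _) (Pd _)))//.
have near n : (M <= n)%N -> N (\sum_(0 <= k < n) f (pi k) - s) <= 2^-1.
  move=> /MP /=; rewrite sub0r normrN ger0_norm ?(sn_ge0 HN)//; exact: ltW.
by rewrite [leRHS](splitr 1) div1r lerD// near// (leq_trans bM)// leq_addr.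
Qed.

End unconditional.

(** * Convolution and Fourier analysis on cyclic groups *)

Section fourier_on_cyclic_groups.
Context {R : realType}.
Implicit Types (z : R[i]).

Lemma prim_root_exists n : (0 < n)%N -> exists z, n.-primitive_root z.
Proof.
pose p : {poly R[i]} := 'X^n - 1; have [r Dp] := closed_field_poly_normal p.
move=> n0; rewrite (monicP _) ?monicXnsubC// scale1r in Dp.
have rn1 : all n.-unity_root r by apply/allP => x; rewrite -root_prod_XsubC -Dp.
have sz_r : (n < (size r).+1)%N by rewrite -(size_prod_XsubC r id) -Dp size_XnsubC.
have [|x _ ?] := hasP (cyclic.has_prim_root n0 rn1 _ sz_r); last by exists x.
rewrite -separable.separable_prod_XsubC -Dp cyclotomic.separable_Xn_sub_1//.
by rewrite pnatr_eq0 -lt0n.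
Qed.

Lemma prim_root_norm n z : (0 < n)%N -> n.-primitive_root z -> `|z| = 1.
Proof.
move=> n0 /prim_expr_order zn; apply/eqP.
by rewrite -(pexpr_eq1 (n := n))// -normrX zn normr1.
Qed.

Lemma sqr_modulusC z : (modulus z ^+ 2)%:C%C = z * z^*%C.
Proof. by rewrite rmorphXn/= -normE sqr_normc. Qed.

Lemma sqr_modulus_sum (I : finType) (F : I -> R[i]) :
  (modulus (\sum_a F a) ^+ 2)%:C%C = \sum_a \sum_b F a * (F b)^*%C.
Proof.
rewrite sqr_modulusC rmorph_sum/= mulr_suml.
by apply: eq_bigr => a _; rewrite mulr_sumr.
Qed.

Lemma norm1_conj z : `|z| = 1 -> z^*%C = z^-1.
Proof. by move=> z1; rewrite invc_norm z1 expr1n invr1 mul1r. Qed.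

Lemma parseval n z (h : 'I_n.+1 -> R[i]) : n.+1.-primitive_root z ->
  \sum_(i < n.+1) modulus (\sum_(a < n.+1) (z ^+ i) ^+ a * h a) ^+ 2 =
  n.+1%:R * \sum_(a < n.+1) modulus (h a) ^+ 2.
Proof.
move=> zP; have z1 := prim_root_norm (ltn0Sn n) zP.
have z0 : z != 0 by rewrite -normr_eq0 z1 oner_eq0.
apply: (@complexI R); rewrite rmorphM rmorph_nat !rmorph_sum/=.
under eq_bigr do rewrite sqr_modulus_sum.
rewrite exchange_big/= mulr_sumr; apply: eq_bigr => a _.
rewrite exchange_big/= (bigD1 a)//= [X in _ + X]big1 ?addr0 => [|b ba].
  rewrite sqr_modulusC (eq_bigr (fun=> h a * (h a)^*%C)).
    by rewrite sumr_const card_ord mulr_natl.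
  move=> i _; rewrite rmorphM/= mulrACA -sqr_normc !normrX z1 !expr1n.
  by rewrite mul1r.
rewrite (eq_bigr (fun i : 'I_n.+1 => h a * (h b)^*%C * (z ^+ a / z ^+ b) ^+ i)).
  rewrite -mulr_sumr; set w := z ^+ a / z ^+ b.
  have w1 : w != 1.
    rewrite /w -(inj_eq (mulIf (expf_neq0 b z0))) divfK ?expf_neq0// mul1r.
    by rewrite (eq_prim_root_expr zP) !modn_small// eq_sym.
  have : (w - 1) * \sum_(i < n.+1) w ^+ i = 0.
    rewrite -subrX1 /w exprMn exprVn -!exprM ![(_ * n.+1)%N]mulnC !exprM.
    by rewrite (prim_expr_order zP) !expr1n divr1 subrr.
  by move/eqP; rewrite mulf_eq0 subr_eq0 (negbTE w1)/= => /eqP ->; rewrite mulr0.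
move=> i _; rewrite rmorphM/= mulrACA mulrC; congr (_ * _).
rewrite rmorphXn rmorphXn/= norm1_conj// exprMn -!exprVn -!exprM.
by rewrite ![(_ * i)%N]mulnC.
Qed.

(** Convolution by a trigonometric polynomial [q] on the line, tested on a
    window, is convolution on a cyclic group large enough that nothing wraps
    around; there characters diagonalise it and Parseval's identity bounds it
    by the supremum of [|q|] over the unit circle. *)
Lemma convolution_bound (c : nat -> R[i]) k (S : R) :
  (forall g : R[i], `|g| = 1 -> modulus (\sum_(0 <= j < k) c j * g ^+ j) <= S) ->
  forall n (h : nat -> R[i]),
  \sum_(0 <= a < n) modulus (\sum_(0 <= j < k) c j * h (a + j)%N) ^+ 2 <=
  S ^+ 2 * \sum_(0 <= b < (n + k).+1) modulus (h b) ^+ 2.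
Proof.
move=> cS n h; set M := (n + k)%N; have [z zP] := prim_root_exists (ltn0Sn M).
have z1 := prim_root_norm (ltn0Sn M) zP.
have z0 : z != 0 by rewrite -normr_eq0 z1 oner_eq0.
pose hh (a : 'I_M.+1) := h a.
(* for [a < n] and [j < k] the sum [a + j] is below [M.+1], so on the window the
   cyclic convolution [cc] is the convolution on the line *)
pose cc (a : 'I_M.+1) := \sum_(0 <= j < k) c j * hh (a + inZp j)%R.
have S0 : 0 <= S by apply: le_trans (cS 1 (normr1 _)); exact: modulus_ge0.
apply: (@le_trans _ _ (\sum_(a < M.+1) modulus (cc a) ^+ 2)).
  rewrite big_mkord (big_ord_widen M.+1 (fun a =>
    modulus (\sum_(0 <= j < k) c j * h (a + j)%N) ^+ 2)); last first.
    by rewrite leqW// leq_addr.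
  rewrite big_mkcond; apply: ler_sum => a _; case: ifP => an; last exact: sqr_ge0.
  rewrite /cc (@eq_big_nat _ _ _ _ _ _
    (fun j => c j * hh (a + inZp j)%R))// => j /andP[_ jk].
  by rewrite /hh /= modnDmr modn_small// leqW// -addSn leq_add// ltnW.
rewrite -(ler_pM2l (ltr0Sn R M)) -(parseval _ zP) mulrCA big_mkord -(parseval _ zP).
rewrite mulr_sumr; apply: ler_sum => i _.
have -> : \sum_(a < M.+1) (z ^+ i) ^+ a * cc a =
    (\sum_(0 <= j < k) c j * ((z ^+ i)^-1) ^+ j) *
    (\sum_(a < M.+1) (z ^+ i) ^+ a * hh a).
  rewrite /cc; under eq_bigr => a _ do rewrite mulr_sumr.
  rewrite exchange_big/= mulr_suml; apply: eq_bigr => j _.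
  rewrite [in RHS](reindex_inj (addIr (inZp j : 'I_M.+1)))/= mulr_sumr.
  apply: eq_bigr => a _; rewrite mulrCA -!mulrA; congr (_ * _).
  rewrite mulrA; congr (_ * _).
  have wP : (z ^+ i) ^+ M.+1 = 1.
    by rewrite -exprM mulnC exprM (prim_expr_order zP) expr1n.
  rewrite modnDmr (expr_mod _ wP) exprVn exprD mulrCA mulVf ?mulr1//.
  by rewrite !expf_neq0.
rewrite modulusM exprMn ler_wpM2r ?sqr_ge0// lerXn2r ?nnegrE ?modulus_ge0//.
by apply: cS; rewrite normfV normrX z1 expr1n invr1.
Qed.

End fourier_on_cyclic_groups.

(** * The Koopman operator *)

Section dynamics.
Context {d : measure_display} {X : measurableType d} {R : realType}.
Context (m : probability X R).
Implicit Types (f : X -> R[i]) (T : X -> X).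

Local Notation nrm := (nrm m).
Local Notation sqint f := (\int[m]_x ((modulus (f x)) ^+ 2)%:E)%E.

Lemma nrm_comp T f : measure_preserving m T -> in_L2 m f ->
  in_L2 m (f \o T) /\ nrm (f \o T) = nrm f.
Proof.
move=> [mT pT] fL; have mf := in_L2_measurable fL.
have mfT : cmeasurable (f \o T) by exact: cmeasurable_comp.
apply: in_L2_sqint_eq => //; first exact: nrm_ge0.
rewrite -sqint_nrm// -[LHS](@ge0_integral_pushforward _ _ _ _ _ _ mT m setT
  (fun x => (modulus (f x) ^+ 2)%:E))//.
- apply: eq_measure_integral => A mA _; exact: pT.
- exact: measurable_sqmod.
- by move=> x _; rewrite lee_fin sqr_ge0.
Qed.

Lemma measure_preserving_iter T n : measure_preserving m T ->
  measure_preserving m (iter n T).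
Proof.
move=> [mT pT]; elim: n => [|n [mi pi]]; first by split; [exact: measurable_id|].
split; first exact: measurableT_comp.
move=> A mA; rewrite /= [_ @^-1` A](_ : _ = iter n T @^-1` (T @^-1` A))//.
by rewrite pi ?pT// -[X in measurable X]setTI; exact: mT.
Qed.

(** Calderon transference: averaged along an orbit, the action of a polynomial
    in the Koopman operator becomes a convolution on a window of integers. *)
Lemma koopman_polynomial_bound T (c : nat -> R[i]) k (S : R) f :
  measure_preserving m T ->
  (forall g : R[i], `|g| = 1 -> modulus (\sum_(0 <= j < k) c j * g ^+ j) <= S) ->
  in_L2 m f ->
  in_L2 m (fun x => \sum_(0 <= j < k) c j * f (iter j T x)) /\
  nrm (fun x => \sum_(0 <= j < k) c j * f (iter j T x)) <= S * nrm f.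
Proof.
move=> pT cS fL.
have S0 : 0 <= S by apply: le_trans (cS 1 (normr1 _)); exact: modulus_ge0.
have pTn n := measure_preserving_iter n pT.
set w := fun x => _; have wL : in_L2 m w.
  rewrite /w; elim: k {cS w} => [|k IH].
    have [] := @in_L2_sqint_bound _ _ _ m (fun=> 0) 0 (cmeasurable_cst _) (lexx _).
      by rewrite integral0_eq// => x _; rewrite modulus0 expr0n.
    by under [in X in _ -> _ -> X]eq_fun do rewrite big_geq//.
  under eq_fun do rewrite big_nat_recr//=.
  apply: (in_L2D_nrm _ _).1 => //; apply: (in_L2Z_nrm _ _).1.
  exact: (nrm_comp (pTn k) fL).1.
split=> //.
have sqT n g : in_L2 m g -> sqint (g \o iter n T) = (nrm g ^+ 2)%:E.
  by move=> gL; have [gTL <-] := nrm_comp (pTn n) gL; rewrite sqint_nrm.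
have sumT n g : in_L2 m g ->
    (\int[m]_x (\sum_(0 <= a < n) modulus (g (iter a T x)) ^+ 2)%:E)%E =
    (n%:R * nrm g ^+ 2)%:E.
  move=> gL; under eq_integral do rewrite -sumEFin.
  rewrite ge0_integral_sum//; last 2 first.
  - move=> a; apply: (@measurable_sqmod _ _ _ (g \o iter a T)).
    exact/in_L2_measurable/(nrm_comp (pTn a) gL).1.
  - by move=> a x _; rewrite lee_fin sqr_ge0.
  under eq_bigr do rewrite (sqT _ _ gL).
  by rewrite sumEFin sumr_const_nat subn0 mulr_natl.
have msum n g : in_L2 m g -> measurable_fun setT
    (fun x => (\sum_(0 <= a < n) modulus (g (iter a T x)) ^+ 2)%:E).
  move=> gL; apply/measurable_EFinP; apply: measurable_sum => a.
  apply: measurable_funX; apply: (@measurable_modulus _ _ _ (g \o iter a T)).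
  exact/in_L2_measurable/(nrm_comp (pTn a) gL).1.
have main n : n%:R * nrm w ^+ 2 <= S ^+ 2 * ((n + k).+1%:R * nrm f ^+ 2).
  rewrite -lee_fin (EFinM (S ^+ 2)) -!sumT//.
  rewrite -ge0_integralZl_EFin ?sqr_ge0//; last 2 first.
  - by move=> x _; rewrite lee_fin sumr_ge0// => a _; exact: sqr_ge0.
  - exact: msum.
  apply: ge0_le_integral => //.
  - by move=> x _; rewrite lee_fin sumr_ge0// => a _; exact: sqr_ge0.
  - exact: msum.
  - by apply: measurable_funeM; exact: msum.
  move=> x _; rewrite -EFinM lee_fin.
  rewrite (le_trans _ (convolution_bound cS n (fun b => f (iter b T x))))//.
  by apply: ler_sum => a _; rewrite /w; under eq_bigr do rewrite -iterD addnC.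
(* letting [n] go to infinity in [main] removes the boundary term [k.+1] *)
suff : nrm w ^+ 2 <= (S * nrm f) ^+ 2.
  by rewrite ler_pXn2r ?nnegrE ?mulr_ge0 ?nrm_ge0.
rewrite leNgt; apply/negP => lt.
have d0 : 0 < nrm w ^+ 2 - (S * nrm f) ^+ 2 by rewrite subr_gt0.
have e0 : 0 <= (S * nrm f) ^+ 2 * k.+1%:R by rewrite mulr_ge0 ?sqr_ge0.
have := archi_boundP (divr_ge0 e0 (ltW d0)); set n := Num.bound _.
rewrite ltr_pdivrMr//; have := main n.
by rewrite -addnS natrD exprMn; nra.
Qed.

End dynamics.

Section two_sided.
Context {R : realType}.

(** The part of a two-sided sum carried by the integers of [-L, L). *)
Definition zpart {V : zmodType} (L : nat) (F : int -> V) : V :=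
  \sum_(0 <= n < L) F (Posz n) + \sum_(0 <= n < L) F (Negz n).

Lemma zpart_shift {V : zmodType} (L : nat) (F : int -> V) :
  zpart L F = \sum_(0 <= j < L + L) F (Posz j - Posz L).
Proof.
rewrite (big_cat_nat (n := L)) ?leq_addr//= addrC /zpart; congr (_ + _).
  rewrite -{2}[L]add0n big_addn addnK; apply: eq_bigr => j _.
  by congr F; rewrite PoszD addrK.
rewrite [in RHS]big_nat_rev/= add0n; apply: eq_big_nat => j /andP[_ jL]; congr F.
by rewrite NegzE -subzn// addrAC subrr sub0r.
Qed.

Lemma ziter_shift {X : Type} (tau tauV : X -> X) (j L : nat) x :
  cancel tauV tau ->
  ziter tau tauV (Posz j - Posz L) x = iter j tau (iter L tauV x).
Proof.
move=> K.
have cK n y : iter n tau (iter n tauV y) = y.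
  by elim: n y => // n IH y; rewrite iterSr /= K IH.
have [Lj|jL] := leqP L j.
  by rewrite subzn//= -{2}(subnK Lj) iterD cK.
have -> : Posz j - Posz L = Negz (L - j).-1.
  by rewrite NegzE prednK ?subn_gt0// -subzn 1?ltnW// opprB.
by rewrite /ziter prednK ?subn_gt0// -{2}(subnKC (ltnW jL)) iterD cK.
Qed.

Context {d : measure_display} {X : measurableType d} (m : probability X R).
Context (tau tauV : X -> X).
Context (tau_inv : measurable_inverse tau tauV).
Context (tau_pres : measure_preserving m tau).

Lemma inverse_preserving : measure_preserving m tauV.
Proof.
have [K KV mV] := tau_inv; split=> // A mA; rewrite -(tau_pres.2).
  by congr (m _); apply/seteqP; split=> x /=; rewrite K.
by rewrite -[X in measurable X]setTI; exact: mV.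
Qed.

Lemma ziter_preserving s : measure_preserving m (ziter tau tauV s).
Proof.
case: s => n; apply: measure_preserving_iter => //; exact: inverse_preserving.
Qed.

(** Negative powers are no obstacle: multiplying the symbol by [g ^ L], and
    composing with the [L]-th iterate of [tau], changes no modulus and no norm. *)
Lemma koopman_trig_bound (c : int -> R[i]) L (S : R) f :
  (forall g : R[i], `|g| = 1 -> modulus (zpart L (fun s => c s * g ^ s)) <= S) ->
  in_L2 m f ->
  nrm m (fun x => zpart L (fun s => c s * f (ziter tau tauV s x))) <= S * nrm m f.
Proof.
move=> cS fL; have [_ KV _] := tau_inv.
pose w x := \sum_(0 <= j < L + L) c (Posz j - Posz L) * f (iter j tau x).
have -> : (fun x => zpart L (fun s => c s * f (ziter tau tauV s x))) =
    w \o iter L tauV.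
  apply/funext => x; rewrite zpart_shift; apply: eq_bigr => j _.
  by rewrite ziter_shift.
have [wL wle] : in_L2 m w /\ nrm m w <= S * nrm m f.
  apply: (koopman_polynomial_bound (c := fun j => c (Posz j - Posz L))) => //.
  move=> g g1; have g0 : g != 0 by rewrite -normr_eq0 g1 oner_eq0.
  apply: le_trans (cS g g1); rewrite zpart_shift.
  rewrite [X in _ <= modulus X](eq_bigr
    (fun j => g ^- L * (c (Posz j - Posz L) * g ^+ j))).
    rewrite -mulr_sumr modulusM modulusV modulusX (modulus_unit g1).
    by rewrite expr1n invr1 mul1r.
  by move=> j _; rewrite expfzDr// exprnN -exprnP mulrA mulrC.
have pV := measure_preserving_iter L inverse_preserving.
by rewrite (nrm_comp pV wL).2.
Qed.

End two_sided.

(** * Approximate eigenvectors of an ergodic transformation *)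

Section approximate_eigenvectors.
Context {d : measure_display} {X : measurableType d} {R : realType}.
Context (m : probability X R).

(** A set that is not an atom splits in two parts of positive measure, of which
    one has at most half the measure. *)
Lemma small_set n : non_atomic m ->
  exists B, [/\ measurable B, (0 < m B)%E & (m B <= (2^-1 ^+ n)%:E)%E].
Proof.
move=> na; elim: n => [|n [A [mA A0 An]]].
  exists setT; split=> //; first by rewrite probability_setT lte01.
  by rewrite probability_setT expr0.
have /not_and3P : ~ atom m A by exact: na.
case=> // /existsNP[B /not_implyP[mB /not_implyP[BA /not_orP[B0 BneA]]]].
have mDE : m A = (m B + m (A `\` B))%E.
  by rewrite (measureDI m mA mB) setIidr// addeC.
have fB : m B \is a fin_num by exact: fin_num_measure.
have fA : m A \is a fin_num by exact: fin_num_measure.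
have mAB : measurable (A `\` B) by exact: measurableD.
have fAB : m (A `\` B) \is a fin_num by exact: fin_num_measure.
have pB : (0 < m B)%E by rewrite lt0e measure_ge0 andbT; apply/eqP.
have pAB : (0 < m (A `\` B))%E.
  rewrite lt0e measure_ge0 andbT; apply/eqP => E; apply: BneA.
  by rewrite mDE E adde0.
move: mDE An pB pAB fB fA fAB.
case EB: (m B) => [b| |]//; case EA: (m A) => [a| |]//.
case EAB: (m (A `\` B)) => [c| |]// [abc].
rewrite lee_fin !lte_fin => an b0 c0 _ _ _.
have [bc|cb] := leP b c.
  exists B; split=> //; rewrite EB ?lte_fin// lee_fin exprS; lra.
exists (A `\` B); split=> //; rewrite EAB ?lte_fin// lee_fin exprS; lra.
Qed.

Context (tau : X -> X).
Context (tau_pres : measure_preserving m tau) (tau_erg : ergodic m tau).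

Let mpre n A : measurable A -> measurable (iter n tau @^-1` A).
Proof.
move=> mA; rewrite -[X in measurable X]setTI.
by have [h _] := measure_preserving_iter n tau_pres; exact: h.
Qed.

Let ppre n A : measurable A -> m (iter n tau @^-1` A) = m A.
Proof. exact: (measure_preserving_iter n tau_pres).2. Qed.

(** Ergodicity speaks of strictly invariant sets only.  The set [W] of points that
    visit [E] infinitely often is strictly invariant, and it agrees with [E]
    off the null set [Z] of points whose orbit ever crosses the boundary of
    [E]. *)
Lemma ergodic_almost_invariant E : measurable E -> (0 < m E)%E ->
  m (E `\` tau @^-1` E) = 0%E -> m E = 1%E.
Proof.
move=> mE E0 EE0.
have mtE : measurable (tau @^-1` E) by exact: (@mpre 1).
have ptE : m (tau @^-1` E) = m E by exact: (@ppre 1).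
have fin A : measurable A -> m A \is a fin_num by exact: fin_num_measure.
have EE0' : m (tau @^-1` E `\` E) = 0%E.
  have h1 : m (tau @^-1` E) =
      (m (tau @^-1` E `\` E) + m (E `&` tau @^-1` E))%E.
    by rewrite setIC; exact: measureDI.
  have h2 : m E = (m (E `\` tau @^-1` E) + m (E `&` tau @^-1` E))%E.
    exact: measureDI.
  move: h1; rewrite ptE h2 EE0 add0e => /esym.
  rewrite -(fineK (fin _ (measurableI _ _ mE mtE))).
  rewrite -(fineK (fin _ (measurableD mtE mE))) -EFinD => -[/eqP].
  by rewrite -subr_eq0 addrK => /eqP ->.
pose D := (E `\` tau @^-1` E) `|` (tau @^-1` E `\` E).
have mD : measurable D by apply: measurableU; exact: measurableD.
have D0 : m D = 0%E.
  have : (m D <= m (E `\` tau @^-1` E) + m (tau @^-1` E `\` E))%E.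
    by apply: measureU2; exact: measurableD.
  by rewrite EE0 EE0' adde0 => le; apply/eqP; rewrite eq_le le measure_ge0.
pose Z := \bigcup_n iter n tau @^-1` D.
have Z0 : m.-negligible Z.
  apply: negligible_bigcup => n; exists (iter n tau @^-1` D); split=> //.
    exact: mpre.
  exact: eq_trans (ppre n mD) D0.
have stay x : ~ Z x -> forall n, E (iter n tau x) <-> E x.
  move=> Zx; elim=> // n IH; rewrite -IH; split=> [h|h]; apply: contrapT => h'.
    by apply: Zx; exists n => //; right; split.
  by apply: Zx; exists n => //; left; split.
pose W := \bigcap_n \bigcup_(k in [set k | (n <= k)%N]) (iter k tau @^-1` E).
have mW : measurable W.
  apply: bigcap_measurableType => n _; apply: bigcup_measurable => k _; exact: mpre.
have Winv : tau @^-1` W = W.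
  apply/seteqP; split=> x /= Wx n _.
    have [k /= nk] := Wx n I; rewrite -iterSr => Ek.
    by exists k.+1 => //=; exact: leqW.
  have [[//|k] /= nk Ek] := Wx n.+1 I.
  by exists k => //=; rewrite -iterSr.
have WE x : ~ Z x -> (W x <-> E x).
  move=> Zx; split=> [/(_ 0%N I)[k _ /stay]|Ex n _]; first exact.
  by exists n => //=; exact/stay.
have WmE : m W = m E.
  have [Z' [mZ' Z'0 ZZ']] := Z0.
  have sub A B : measurable A -> measurable B -> (forall x, ~ Z x -> A x -> B x) ->
      (m A <= m B)%E.
    move=> mA mB AB; rewrite -[leRHS]adde0 -Z'0.
    apply: le_trans (measureU2 _ mB mZ'); apply: le_measure; rewrite ?inE//.
      exact: measurableU.
    move=> x Ax; have [Zx|Zx] := pselect (Z x); first by right; exact: ZZ'.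
    by left; exact: AB.
  apply/eqP; rewrite eq_le !sub// => x Zx; first by move/WE; exact.
  by move=> Wx; exact/WE.
have [W0|<-//] := tau_erg mW Winv.
by move: E0; rewrite -WmE W0 ltxx.
Qed.

(** A weak Rokhlin lemma.  From a set [B] with [m B < 1 / N], take away the points
    that come back before time [N]; were only a null set left, the union of the
    first [N] preimages of [B] would be almost invariant, though of measure
    less than 1. *)
Lemma tower N : non_atomic m -> exists A, [/\ measurable A, (0 < m A)%E &
  forall x j, (0 < j < N)%N -> A x -> ~ A (iter j tau x)].
Proof.
move=> na; have [B [mB B0 BN]] := small_set N na.
pose C := \bigcup_(j in [set j | (0 < j < N)%N]) (iter j tau @^-1` B).
have mC : measurable C by apply: bigcup_measurable => j _; exact: mpre.
exists (B `\` C); split; first exact: measurableD.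
- rewrite lt0e measure_ge0 andbT; apply/eqP => BC0.
  pose E := \big[setU/set0]_(j < N) (iter j tau @^-1` B).
  have EP x : E x <-> exists2 j, (j < N)%N & B (iter j tau x).
    rewrite /E -(bigcup_mkord N (fun j => iter j tau @^-1` B)).
    by split=> -[j jN Bj]; exists j.
  have mE : measurable E by apply: bigsetU_measurable => j _; exact: mpre.
  have Nlt : (0 < N)%N.
    case: N BN @C mC BC0 {E EP mE} => // _ C _; rewrite /C bigcup0 ?setD0.
      by move=> E; move: B0; rewrite E ltxx.
    by move=> j /= /andP[].
  have BE : B `<=` E by move=> x Bx; apply/EP; exists 0%N.
  have E0 : (0 < m E)%E by apply: lt_le_trans B0 (le_measure _ _ _ BE); rewrite inE.
  have : m E = 1%E.
    apply: ergodic_almost_invariant => //; apply/eqP.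
    rewrite eq_le measure_ge0 andbT -BC0; apply: le_measure; rewrite ?inE.
    - by apply: measurableD => //; exact: (@mpre 1).
    - exact: measurableD.
    move=> x [/EP[j jN Bj] tEx]; case: j jN Bj => [|j] jN Bj.
      split=> // -[[//|i] /= iN Bi]; apply: tEx; apply/EP.
      by exists i; [exact: ltnW|rewrite -iterSr].
    by exfalso; apply: tEx; apply/EP; exists j; [exact: ltnW|rewrite -iterSr].
  apply/eqP; rewrite lt_eqF//.
  apply: (@le_lt_trans _ _ (\sum_(j < N) m (iter j tau @^-1` B))%E).
    by apply: (@Boole_inequality _ _ _ m (fun j => iter j tau @^-1` B)) => j _;
      exact: mpre.
  under eq_bigr do rewrite ppre//.
  apply: (@le_lt_trans _ _ (\sum_(j < N) (2^-1 ^+ N)%:E)%E); first exact: lee_sum.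
  rewrite sumEFin lte_fin sumr_const card_ord -[ltLHS]mulr_natl exprVn.
  by rewrite ltr_pdivrMr ?exprn_gt0// mul1r -natrX ltr_nat ltn_expl.
- by move=> x j jN [Bx Cx] [Bj _]; apply: Cx; exists j.
Qed.

(** Over a tower of height [N] with base [A], the function equal to [g ^- j] on
    the [j]-th preimage of [A] satisfies the eigenvalue equation except at
    the two ends of the tower, which carry a proportion [O(1 / N)] of its
    squared norm. *)
Lemma approximate_eigenvector (g : R[i]) (e : R) : non_atomic m -> `|g| = 1 ->
  0 < e -> exists f, [/\ in_L2 m f, 0 < nrm m f &
    nrm m (fun x => f (tau x) - g * f x) <= e * nrm m f].
Proof.
move=> na g1 e0; have g0 : g != 0 by rewrite -normr_eq0 g1 oner_eq0.
have := archi_boundP (divr_ge0 (ler0n R 4) (sqr_ge0 e)); set N := Num.bound _.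
rewrite ltr_pdivrMr ?exprn_gt0// => eN.
have [A [mA A0 Aret]] := tower N.+1 na.
pose v j x : R[i] := g ^- j * (\1_A (iter j tau x))%:C%C.
have fA : m A \is a fin_num by exact: fin_num_measure.
pose r := Num.sqrt (fine (m A)).
have r0 : 0 < r by rewrite sqrtr_gt0 fine_gt0// A0 ltey_eq fA.
have rE : r ^+ 2 = fine (m A) by rewrite sqr_sqrtr// fine_ge0.
have [oneL oneN] : in_L2 m (fun x => (\1_A x)%:C%C : R[i]) /\
    nrm m (fun x => (\1_A x)%:C%C : R[i]) = r.
  apply: in_L2_sqint_eq; [|exact: ltW|].
    by split=> //=; exact: measurable_indic.
  rewrite rE fineK// -[X in _ = m X](setIT A) -integral_indic//.
  apply: eq_integral => x _; rewrite modulus_real ?indicE//.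
  by case: (x \in A); rewrite ?expr1n// expr0n.
have vP j : in_L2 m (v j) /\ nrm m (v j) = r.
  have [cL cN] := nrm_comp (measure_preserving_iter j tau_pres) oneL.
  have [vL vN] := in_L2Z_nrm (g ^- j) cL.
  split=> //; rewrite /v vN cN oneN modulusV modulusX (modulus_unit g1).
  by rewrite expr1n invr1 mul1r.
have vE j x : v j (tau x) = g * v j.+1 x.
  by rewrite /v -iterSr mulrA exprS invfM mulrA divff// mul1r.
pose f n x := \sum_(0 <= j < n) v j x.
have fP n : (n <= N.+1)%N -> in_L2 m (f n) /\ nrm m (f n) = Num.sqrt n%:R * r.
  elim: n => [_|n IH nN].
    rewrite sqrtr0 mul0r; apply: in_L2_sqint_eq => //.
      by apply: cmeasurable_sum => j; exact/in_L2_measurable/(vP j).1.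
    rewrite integral0_eq ?expr0n// => x _.
    by rewrite /f big_geq// modulus0 expr0n.
  have [fL fN] := IH (ltnW nN); have [vL vN] := vP n.
  have fE x : f n.+1 x = f n x + v n x by rewrite /f big_nat_recr.
  apply: in_L2_sqint_eq.
  - by apply: cmeasurable_sum => j; exact/in_L2_measurable/(vP j).1.
  - by rewrite mulr_ge0 ?sqrtr_ge0// ltW.
  (* the levels of the tower are disjoint *)
  have pyth x :
      modulus (f n.+1 x) ^+ 2 = modulus (f n x) ^+ 2 + modulus (v n x) ^+ 2.
    rewrite fE; have [An|An] := boolP (iter n tau x \in A); last first.
      by rewrite /v indicE (negbTE An) mulr0 modulus0 expr0n !addr0.
    rewrite (_ : f n x = 0) ?modulus0 ?expr0n ?add0r//.
    rewrite /f big_nat big1// => j /andP[_ jn].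
    rewrite /v indicE (_ : _ \in A = false) ?mulr0//; apply/negP => /set_mem Aj.
    move/set_mem: An; rewrite -(subnK (ltnW jn)) iterD; apply: Aret Aj.
    by rewrite subn_gt0 jn (leq_ltn_trans (leq_subr _ _)).
  under eq_integral do rewrite pyth EFinD.
  rewrite ge0_integralD//; last 4 first.
  - by move=> x _; rewrite lee_fin sqr_ge0.
  - exact: (measurable_sqmod (in_L2_measurable fL)).
  - by move=> x _; rewrite lee_fin sqr_ge0.
  - exact: (measurable_sqmod (in_L2_measurable vL)).
  rewrite !sqint_nrm// fN vN -EFinD; congr EFin.
  by rewrite !exprMn !(sqr_sqrtr (ler0n _ _)) -[n.+1]addn1 natrD mulrDl mul1r.
have [fL fN] := fP N (leqnSn N).
have N0 : (0 < N)%N.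
  by rewrite lt0n; apply/eqP => E; move: eN; rewrite E mul0r ltrn0.
exists (f N); split=> //; first by rewrite fN mulr_gt0// sqrtr_gt0 ltr0n.
(* only the top and the bottom of the tower remain *)
have dE : (fun x => f N (tau x) - g * f N x) =
    (fun x => g * v N x + - g * v 0%N x).
  apply/funext => x; rewrite /f mulr_sumr; under eq_bigr do rewrite vE.
  by rewrite -sumrB mulNr (telescope_sumr (fun j => g * v j x)).
have [gL gN] := in_L2Z_nrm g (vP N).1.
have [hL hN] := in_L2Z_nrm (- g) (vP 0%N).1.
rewrite dE (le_trans (in_L2D_nrm gL hL).2)// gN hN modulusN (modulus_unit g1).
rewrite (vP N).2 (vP 0%N).2 fN mulrA mul1r -mulr2n -[leLHS]mulr_natl.
rewrite ler_pM2r//.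
rewrite -(ler_pXn2r (n := 2)) ?nnegrE ?mulr_ge0 ?sqrtr_ge0 ?ltW//.
by rewrite exprMn sqr_sqrtr// mulrC -natrX.
Qed.

End approximate_eigenvectors.

(** * Averages along orbits and their truncations *)

Section zpart_theory.
Context {R : realType}.

Lemma zpart0 {V : zmodType} (F : int -> V) : zpart 0 F = 0.
Proof. by rewrite /zpart !big_geq// addr0. Qed.

Lemma zpart_mull (a : R[i]) L (F : int -> R[i]) :
  a * zpart L F = zpart L (fun s => a * F s).
Proof. by rewrite /zpart mulrDr !mulr_sumr. Qed.

Lemma zpartD L (F G : int -> R[i]) :
  zpart L (fun s => F s + G s) = zpart L F + zpart L G.
Proof. by rewrite /zpart !big_split/= addrACA. Qed.

Lemma zpartB L (F G : int -> R[i]) :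
  zpart L F - zpart L G = zpart L (fun s => F s - G s).
Proof. by rewrite /zpart opprD addrACA -!sumrB. Qed.

Lemma zpart_sum n L (F : nat -> int -> R[i]) :
  \sum_(0 <= k < n) zpart L (F k) = zpart L (fun s => \sum_(0 <= k < n) F k s).
Proof.
by rewrite /zpart big_split/=; congr (_ + _); rewrite exchange_big.
Qed.

End zpart_theory.

Section L2_space.
Context {d : measure_display} {X : measurableType d} {R : realType}.
Context (m : probability X R).

Lemma L2_complete_seminorm :
  complete_seminorm (in_L2 m : (X -> R[i]^o) -> Prop) (nrm m).
Proof.
have L20 : in_L2 m (fun=> 0) by have [] := @in_L2_sqint_bound _ _ _ m (fun=> 0) 0
  (cmeasurable_cst _) (lexx _);
  rewrite ?integral0_eq// => x _; rewrite modulus0 expr0n.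
split=> //.
- by move=> f g fL gL; exact: (in_L2D_nrm fL gL).1.
- by move=> c f fL; exact: (in_L2Z_nrm c fL).1.
- exact: nrm_ge0.
- by move=> f g fL gL; exact: (in_L2D_nrm fL gL).2.
- by move=> c f fL; exact: (in_L2Z_nrm c fL).2.
move=> g a A gL ga aA; have [sL sP] := L2_series_limn gL ga aA.
eexists; split; first exact: sL.
move=> n; apply: le_trans (sP n); rewrite le_eqVlt; apply/orP; left; apply/eqP.
by congr (nrm m _); apply/funext => x; rewrite !fctE fct_sumE.
Qed.

End L2_space.

Section masses.
Context {R : realType}.
Implicit Types mu : probability int R.

Definition pmass mu (s : int) : R := fine (mu [set s]).

Lemma pmass_ge0 mu s : 0 <= pmass mu s.
Proof. by rewrite fine_ge0. Qed.

Lemma modulus_mass mu s : modulus (mass mu s) = pmass mu s.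
Proof. by rewrite modulus_real// pmass_ge0. Qed.

Lemma pmass_series mu (e : nat -> int) : injective e ->
  \sum_(0 <= k < n) pmass mu (e k) @[n --> \oo] --> fine (mu (range e)).
Proof.
move=> inj.
have tF : trivIset setT (fun k => [set e k]).
  by apply/trivIsetP => i j _ _ ij; apply/seteqP; split=> // x [/= -> /inj/eqP];
    rewrite (negbTE ij).
have mF k : measurable [set e k] by [].
have := @measure_sigma_additive _ _ _ mu _ mF tF.
have -> : \bigcup_k [set e k] = range e.
  by apply/seteqP; split=> x [k _ /= ex]; exists k.
rewrite -[X in _ --> X]fineK ?fin_num_measure// => /fine_cvg.
apply: cvg_trans; apply: near_eq_cvg; apply: nearW => n /=.
rewrite -[RHS]/(fine (_)%:E) -sumEFin; congr fine.
by apply: eq_bigr => k _; rewrite fineK ?fin_num_measure.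
Qed.

Lemma pmass_sum_le mu (e : nat -> int) n : injective e ->
  \sum_(0 <= k < n) pmass mu (e k) <= fine (mu (range e)).
Proof.
move=> inj; have c := @pmass_series mu e inj; rewrite -(cvg_lim _ c)//.
apply: nondecreasing_cvgn_le; last by apply/cvg_ex; eexists; exact: c.
by apply/nondecreasing_seqP => k; rewrite big_nat_recr//= lerDl pmass_ge0.
Qed.

Lemma Posz_inj : injective Posz. Proof. by move=> i j []. Qed.
Lemma Negz_inj : injective Negz. Proof. by move=> i j []. Qed.

Lemma pmass_total mu : fine (mu (range Posz)) + fine (mu (range Negz)) = 1.
Proof.
apply: EFin_inj; rewrite EFinD !fineK ?fin_num_measure//.
rewrite -measureU//.
  have -> : range Posz `|` range Negz = setT.
    by apply/seteqP; split=> // -[n|n] _; [left|right]; exists n.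
  exact: probability_setT.
by apply/seteqP; split=> // _ [[n _ <-] [k _]].
Qed.

(** The mass that [mu] gives to the integers outside [-L, L). *)
Definition tail mu (L : nat) : R := 1 - zpart L (pmass mu).

Lemma tailE mu L : tail mu L =
  (fine (mu (range Posz)) - \sum_(0 <= k < L) pmass mu (Posz k)) +
  (fine (mu (range Negz)) - \sum_(0 <= k < L) pmass mu (Negz k)).
Proof. by rewrite /tail -(pmass_total mu) /zpart opprD addrACA. Qed.

Lemma tail_cvg0 mu : tail mu L @[L --> \oo] --> (0 : R).
Proof.
rewrite -(subrr 1) -{2}(pmass_total mu) /tail /zpart.
apply: cvgB; first exact: cvg_cst.
by apply: cvgD; apply: pmass_series; [exact: Posz_inj|exact: Negz_inj].
Qed.

Lemma fourier_tail mu (g : R[i]) L : `|g| = 1 ->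
  modulus (fourier mu g - zpart L (fun s => mass mu s * g ^ s)) <= tail mu L.
Proof.
move=> g1; rewrite tailE /fourier /zsum /zpart opprD addrACA.
have term s : modulus (mass mu s * g ^ s) <= pmass mu s.
  rewrite modulusM modulus_mass; case: s => n.
    by rewrite -exprnP modulusX (modulus_unit g1) expr1n mulr1.
  by rewrite NegzE -exprnN modulusV modulusX (modulus_unit g1) expr1n invr1 mulr1.
apply: le_trans (modulusD _ _) _; apply: lerD.
  apply: (@cseries_tail _ _ (fun n => pmass mu (Posz n))) => // n.
  by apply: pmass_sum_le; exact: Posz_inj.
apply: (@cseries_tail _ _ (fun n => pmass mu (Negz n))) => // n.
by apply: pmass_sum_le; exact: Negz_inj.
Qed.

Context {d : measure_display} {X : measurableType d} (m : probability X R).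
Context (tau tauV : X -> X).
Context (tau_inv : measurable_inverse tau tauV).
Context (tau_pres : measure_preserving m tau).

(** The average is defined pointwise, by series that may diverge on a null set;
    the truncated averages, to which it is close in norm, are honest linear
    combinations of iterates of [f]. All later facts about averages are
    obtained from the truncated ones by letting [L] go to infinity. *)
Lemma average_tail mu f L : in_L2 m f ->
  in_L2 m (average tau tauV mu f) /\
  nrm m (fun x => average tau tauV mu f x -
    zpart L (fun s => mass mu s * f (ziter tau tauV s x))) <= tail mu L * nrm m f.
Proof.
move=> fL.
pose F s x := mass mu s * f (ziter tau tauV s x).
have FP s : in_L2 m (F s) /\ nrm m (F s) = pmass mu s * nrm m f.
  have [cL cN] := nrm_comp (ziter_preserving tau_inv tau_pres s) fL.
  by have [FL FN] := in_L2Z_nrm (mass mu s) cL; rewrite FN cN modulus_mass.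
have half (e : nat -> int) : injective e ->
    let s x := limn (series (fun k => F (e k) x : R[i]^o)) : R[i] in
    in_L2 m s /\ in_L2 m (fun x => s x - \sum_(0 <= k < L) F (e k) x) /\
    nrm m (fun x => s x - \sum_(0 <= k < L) F (e k) x) <=
    (fine (mu (range e)) - \sum_(0 <= k < L) pmass mu (e k)) * nrm m f.
  move=> inj s.
  have [||n|sL sN] := @L2_series_limn _ _ _ m (fun k => F (e k))
    (fun k => pmass mu (e k) * nrm m f) (fine (mu (range e)) * nrm m f).
  - by move=> k; exact: (FP (e k)).1.
  - by move=> k; rewrite (FP (e k)).2.
  - by rewrite -mulr_suml ler_wpM2r ?nrm_ge0// pmass_sum_le.
  split=> //; split; last by rewrite mulrBl mulr_suml.
  have := sn_B (L2_complete_seminorm m) sL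
    (@sn_sum _ _ _ _ (L2_complete_seminorm m) _ (index_iota 0 L) xpredT
      (fun k => F (e k)) (fun k => (FP (e k)).1)).
  by congr (in_L2 m _); apply/funext => x; rewrite !fctE fct_sumE.
have [pL [pL' pN]] := half Posz Posz_inj.
have [nL [nL' nN]] := half Negz Negz_inj.
split; first exact: (in_L2D_nrm pL nL).1.
rewrite tailE mulrDl; apply: le_trans (lerD pN nN).
apply: le_trans (in_L2D_nrm pL' nL').2; rewrite le_eqVlt; apply/orP; left.
apply/eqP; congr (nrm m _); apply/funext => x.
by rewrite /average /zsum /zpart opprD addrACA.
Qed.

Lemma ziter_sum_in_L2 (c : int -> R[i]) L f : in_L2 m f ->
  in_L2 m (fun x => zpart L (fun s => c s * f (ziter tau tauV s x))).
Proof.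
move=> fL.
have FP s : in_L2 m (fun x => c s * f (ziter tau tauV s x)).
  by have [cL _] := nrm_comp (ziter_preserving tau_inv tau_pres s) fL;
    exact: (in_L2Z_nrm (c s) cL).1.
have sumL (e : nat -> int) :
    in_L2 m (fun x => \sum_(0 <= k < L) c (e k) * f (ziter tau tauV (e k) x)).
  have := @sn_sum _ _ _ _ (L2_complete_seminorm m) _ (index_iota 0 L) xpredT
      (fun k x => c (e k) * f (ziter tau tauV (e k) x)) (fun k => FP (e k)).
  by congr (in_L2 m _); apply/funext => x; rewrite fct_sumE.
exact: (in_L2D_nrm (sumL Posz) (sumL Negz)).1.
Qed.

End masses.

(** * Norms of combinations of averages *)

Section multipliers.
Context {R : realType} {d : measure_display} {X : measurableType d}.
Context (m : probability X R) (tau tauV : X -> X).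
Context (tau_inv : measurable_inverse tau tauV).
Context (tau_pres : measure_preserving m tau).
Context (n : nat) (c : nat -> R[i]) (al be : nat -> probability int R).
Implicit Types f : X -> R[i].

Local Notation HN := (L2_complete_seminorm m).
Local Notation zi := (ziter tau tauV).

(** The operator obtained from a finite combination of differences of averages;
    [symb] is the function of the Koopman operator that it is, and [multL] and
    [symbL] are the parts with powers in [-L, L). *)
Definition mult f x : R[i] := \sum_(0 <= k < n)
  c k * (average tau tauV (al k) f x - average tau tauV (be k) f x).
Definition symb (g : R[i]) : R[i] :=
  \sum_(0 <= k < n) c k * (fourier (al k) g - fourier (be k) g).
Definition mult_coef (s : int) : R[i] :=
  \sum_(0 <= k < n) c k * (mass (al k) s - mass (be k) s).
Definition multL (L : nat) f x : R[i] :=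
  zpart L (fun s => mult_coef s * f (zi s x)).
Definition symbL (L : nat) (g : R[i]) : R[i] :=
  zpart L (fun s => mult_coef s * g ^ s).
Definition mult_tail (L : nat) : R :=
  \sum_(0 <= k < n) modulus (c k) * (tail (al k) L + tail (be k) L).

Lemma mult_tail_cvg0 : mult_tail L @[L --> \oo] --> (0 : R).
Proof.
have -> : (0 : R) = \sum_(0 <= k < n) 0 by rewrite big1.
apply: cvg_big => [|k _]; first exact: add_continuous.
rewrite -[X in _ --> X](mulr0 (modulus (c k))); apply: cvgMl_tmp.
by rewrite -[X in _ --> X]addr0; apply: cvgD; exact: tail_cvg0.
Qed.

Lemma zpart_mult_coef L (F : int -> R[i]) :
  \sum_(0 <= k < n) c k * (zpart L (fun s => mass (al k) s * F s) -
    zpart L (fun s => mass (be k) s * F s)) = zpart L (fun s => mult_coef s * F s).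
Proof.
under eq_bigr do rewrite zpartB zpart_mull.
rewrite zpart_sum; congr (zpart L _); apply/funext => s.
rewrite /mult_coef mulr_suml; apply: eq_bigr => k _.
by rewrite -mulrBl mulrA.
Qed.

Lemma symb_tail L g : `|g| = 1 -> modulus (symb g - symbL L g) <= mult_tail L.
Proof.
move=> g1; rewrite /symb /symbL -zpart_mult_coef -sumrB.
apply: le_trans (modulus_sum _ _ _) _; apply: ler_sum => k _.
rewrite -mulrBr modulusM ler_wpM2l ?modulus_ge0//.
set fa := fourier _ _; set fb := fourier _ _.
set za := zpart _ _; set zb := zpart _ _.
rewrite (_ : fa - fb - (za - zb) = (fa - za) - (fb - zb)); last by ring.
by apply: le_trans (modulusB _ _) _; apply: lerD; exact: fourier_tail.
Qed.

Lemma multL_in_L2 L f : in_L2 m f -> in_L2 m (multL L f).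
Proof. exact: ziter_sum_in_L2. Qed.

Lemma mult_bounds L f : in_L2 m f ->
  in_L2 m (mult f) /\
  nrm m (fun x => mult f x - multL L f x) <= mult_tail L * nrm m f.
Proof.
move=> fL.
have aP mu := average_tail tau_inv tau_pres mu L fL.
have zP mu : in_L2 m (fun x => zpart L (fun s => mass mu s * f (zi s x))).
  by exact: ziter_sum_in_L2.
have BP (f1 f2 : X -> R[i]) : in_L2 m f1 -> in_L2 m f2 ->
    in_L2 m (fun x => f1 x - f2 x) /\
    nrm m (fun x => f1 x - f2 x) <= nrm m f1 + nrm m f2.
  by move=> ? ?; split; [exact: (sn_B HN)|exact: (sn_normB HN)].
have sumP (F : nat -> X -> R[i]) : (forall k, in_L2 m (F k)) ->
    in_L2 m (fun x => \sum_(0 <= k < n) F k x) /\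
    nrm m (fun x => \sum_(0 <= k < n) F k x) <= \sum_(0 <= k < n) nrm m (F k).
  move=> FL; have -> : (fun x => \sum_(0 <= k < n) F k x) =
      \sum_(0 <= k < n) (F k : X -> R[i]^o) by apply/funext => x; rewrite fct_sumE.
  by split; [exact: (sn_sum HN)|exact: (sn_norm_sum HN)].
split.
  apply: (sumP (fun k x => _) _).1 => k; apply: (in_L2Z_nrm _ _).1.
  exact: (BP _ _ (aP _).1 (aP _).1).1.
pose Dk mu x := average tau tauV mu f x - zpart L (fun s => mass mu s * f (zi s x)).
have DP mu : in_L2 m (Dk mu) /\ nrm m (Dk mu) <= tail mu L * nrm m f.
  by split; [exact: (BP _ _ (aP mu).1 (zP mu)).1|exact: (aP mu).2].
have -> : (fun x => mult f x - multL L f x) =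
    (fun x => \sum_(0 <= k < n) c k * (Dk (al k) x - Dk (be k) x)).
  apply/funext => x; rewrite /mult /multL -zpart_mult_coef -sumrB.
  apply: eq_bigr => k _; rewrite -mulrBr; congr (_ * _).
  by rewrite /Dk !opprB !addrA; ring.
have DBP k := BP _ _ (DP (al k)).1 (DP (be k)).1.
have ZP k := in_L2Z_nrm (c k) (DBP k).1.
apply: le_trans (sumP _ (fun k => (ZP k).1)).2 _.
rewrite /mult_tail mulr_suml; apply: ler_sum => k _.
rewrite (ZP k).2 -mulrA ler_wpM2l ?modulus_ge0// (le_trans (DBP k).2)// mulrDl.
by apply: lerD; exact: (DP _).2.
Qed.

Lemma nrm_multL_cvg f : in_L2 m f ->
  nrm m (multL L f) @[L --> \oo] --> nrm m (mult f).
Proof.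
move=> fL; apply/cvgrPdist_le => e e0.
have /cvgrPdist_le/(_ e e0) : mult_tail L * nrm m f @[L --> \oo] --> (0 : R).
  rewrite -[X in _ --> X](mul0r (nrm m f)); apply: cvgMr_tmp.
  exact: mult_tail_cvg0.
apply: filterS => L; rewrite sub0r normrN => tle.
have [TL Tle] := mult_bounds L fL; have TLL := multL_in_L2 L fL.
have dle : nrm m (fun x => mult f x - multL L f x) <= e.
  by rewrite (le_trans Tle)// (le_trans (ler_norm _)).
have h1 := sn_normD HN (sn_B HN TL TLL) TLL.
have h2 := sn_normB HN TL (sn_B HN TL TLL).
rewrite subrK in h1; rewrite opprB addrC subrK in h2.
rewrite ler_distl; apply/andP; split.
  by rewrite lerBlDr (le_trans h2)// lerD2l.
by rewrite (le_trans h1)// addrC lerD2l.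
Qed.

(** Averages of a sum and sums of averages may differ on a null set; the norms
    do not see it, and the truncations are linear everywhere. *)
Lemma mult_normD f1 f2 : in_L2 m f1 -> in_L2 m f2 ->
  nrm m (mult (fun x => f1 x + f2 x)) <= nrm m (mult f1) + nrm m (mult f2).
Proof.
move=> L1 L2; have L12 := (in_L2D_nrm L1 L2).1.
apply: (ler_cvg_to (nrm_multL_cvg L12)
  (cvgD (nrm_multL_cvg L1) (nrm_multL_cvg L2))).
apply: nearW => L.
apply: le_trans (in_L2D_nrm (multL_in_L2 L L1) (multL_in_L2 L L2)).2.
rewrite le_eqVlt; apply/orP; left; apply/eqP; congr (nrm m _); apply/funext => x.
rewrite /multL -zpartD; congr (zpart L _); apply/funext => s.
by rewrite mulrDr.
Qed.

Lemma mult_normZ (a : R[i]) f : in_L2 m f ->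
  nrm m (mult (fun x => a * f x)) = modulus a * nrm m (mult f).
Proof.
move=> fL; have aL := (in_L2Z_nrm a fL).1.
apply: (cvg_unique _ (nrm_multL_cvg aL)) => //.
have -> : (fun L => nrm m (multL L (fun x => a * f x))) =
    (fun L => modulus a * nrm m (multL L f)).
  apply/funext => L; rewrite -(in_L2Z_nrm a (multL_in_L2 L fL)).2.
  congr (nrm m _); apply/funext => x; rewrite /multL zpart_mull.
  by congr (zpart L _); apply/funext => s; rewrite mulrCA.
by apply: cvgMl_tmp; exact: nrm_multL_cvg.
Qed.

Lemma mult_norm_le f : in_L2 m f -> nrm m (mult f) <= mult_tail 0 * nrm m f.
Proof.
move=> fL; have [_] := mult_bounds 0 fL.
by under eq_fun do rewrite /multL zpart0 subr0.
Qed.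

(** Von Neumann's inequality for the Koopman operator.  The truncated symbol
    exceeds [S] by at most [mult_tail L], which tends to 0. *)
Lemma mult_norm_le_symb (S : R) f :
  (forall g : R[i], `|g| = 1 -> modulus (symb g) <= S) -> in_L2 m f ->
  nrm m (mult f) <= S * nrm m f.
Proof.
move=> pS fL.
have lim : (S + mult_tail L) * nrm m f @[L --> \oo] --> S * nrm m f.
  apply: cvgMr_tmp; rewrite -[X in _ --> X]addr0; apply: cvgD; first exact: cvg_cst.
  exact: mult_tail_cvg0.
apply: (ler_cvg_to (nrm_multL_cvg fL) lim); apply: nearW => L.
apply: (koopman_trig_bound tau_inv tau_pres) => // g g1.
rewrite -(subKr (symb g) (zpart _ _)) (le_trans (modulusB _ _))// lerD ?pS//.
exact: symb_tail.
Qed.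

(** An error made by one step is made at most [|s|] times in [s] steps. *)
Lemma iterate_eigen (g : R[i]) f s : `|g| = 1 -> in_L2 m f ->
  in_L2 m (fun x => f (zi s x) - g ^ s * f x) /\
  nrm m (fun x => f (zi s x) - g ^ s * f x) <=
  `|s|%N%:R * nrm m (fun x => f (tau x) - g * f x).
Proof.
move=> g1 fL; have g0 : g != 0 by rewrite -normr_eq0 g1 oner_eq0.
have BL (h1 h2 : X -> R[i]) : in_L2 m h1 -> in_L2 m h2 ->
    in_L2 m (fun x => h1 x - h2 x).
  by move=> ? ?; exact: (sn_B HN).
have dL : in_L2 m (fun x => f (tau x) - g * f x).
  by apply: BL; [exact: (nrm_comp tau_pres fL).1|exact: (in_L2Z_nrm g fL).1].
set D := nrm m (fun x => f (tau x) - g * f x).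
have pos k : in_L2 m (fun x => f (iter k tau x) - g ^+ k * f x) /\
    nrm m (fun x => f (iter k tau x) - g ^+ k * f x) <= k%:R * D.
  elim: k => [|k [kL kN]].
    have -> : (fun x => f (iter 0 tau x) - g ^+ 0 * f x) = (fun=> 0 * 0).
      by apply/funext => x; rewrite expr0 mul1r subrr mul0r.
    have [zL ->] := in_L2Z_nrm 0 (sn_0 HN); rewrite modulus0 !mul0r.
    by split=> //; exact: (sn_0 HN).
  have [tL tN] := nrm_comp tau_pres kL.
  have [gL gN] := in_L2Z_nrm (g ^+ k) dL.
  have -> : (fun x => f (iter k.+1 tau x) - g ^+ k.+1 * f x) =
    (fun x => ((fun x => f (iter k tau x) - g ^+ k * f x) \o tau) x +
              g ^+ k * (f (tau x) - g * f x)).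
    by apply/funext => x; rewrite /= -iterSr mulrBr addrA subrK exprSr mulrA.
  have [sL sN] := in_L2D_nrm tL gL; split=> //.
  rewrite (le_trans sN)// tN gN modulusX (modulus_unit g1) expr1n mul1r.
  by rewrite -natr1 mulrDl mul1r lerD2r.
case: s => k; first exact: pos.
have [K KV _] := tau_inv.
have pV := measure_preserving_iter k.+1 (inverse_preserving tau_inv tau_pres).
have [kL kN] := pos k.+1; have [vL vN] := nrm_comp pV kL.
have [aL aN] := in_L2Z_nrm (- g ^- k.+1) vL.
have -> : (fun x => f (zi (Negz k) x) - g ^ Negz k * f x) =
   (fun x => - g ^- k.+1 *
      ((fun x => f (iter k.+1 tau x) - g ^+ k.+1 * f x) \o iter k.+1 tauV) x).
  apply/funext => x; rewrite /= NegzE -exprnN.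
  have cK j y : iter j tau (iter j tauV y) = y.
    by elim: j y => // j IH y; rewrite iterSr /= KV IH.
  have := cK k.+1 x => /= ->.
  by rewrite mulrBr !mulNr opprK mulrA mulVf ?expf_neq0// mul1r addrC.
split=> //; rewrite aN vN modulusN modulusV modulusX (modulus_unit g1).
by rewrite expr1n invr1 mul1r; exact: kN.
Qed.

(** Every point [g] of the unit circle lies in the approximate spectrum of the
    Koopman operator: on an approximate eigenvector, the combination of
    averages acts nearly as multiplication by its symbol at [g]. *)
Lemma symb_le_mult_norm (C : R) (g : R[i]) :
  non_atomic m -> ergodic m tau -> `|g| = 1 ->
  (forall f, in_L2 m f -> nrm m (mult f) <= C * nrm m f) ->
  modulus (symb g) <= C.
Proof.
move=> na erg g1 TC.
suff main L : modulus (symb g) <= C + 2 * mult_tail L.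
  have lim : C + 2 * mult_tail L @[L --> \oo] --> C.
    rewrite -[X in _ --> X]addr0 -(mulr0 2); apply: cvgD; first exact: cvg_cst.
    by apply: cvgMl_tmp; exact: mult_tail_cvg0.
  by apply: (ler_cvg_to (cvg_cst _) lim); exact: nearW.
(* [K] bounds the error of [multL L] on an eigenvector with error 1 *)
pose K := zpart L (fun s => modulus (mult_coef s) * `|s|%N%:R).
have K0 : 0 <= K.
  by rewrite addr_ge0// sumr_ge0// => k _; rewrite mulr_ge0// modulus_ge0.
apply/ler_addgt0Pr => e e0.
have e'0 : 0 < e / (K + 1) by rewrite divr_gt0// ltr_wpDl.
have [f [fL f0 fe]] := approximate_eigenvector tau_pres erg na g1 e'0.
have [TL Tle] := mult_bounds L fL; have TLL := multL_in_L2 L fL.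
have SL := (in_L2Z_nrm (symb g) fL).
have near : in_L2 m (fun x => multL L f x - symbL L g * f x) /\
    nrm m (fun x => multL L f x - symbL L g * f x) <= e * nrm m f.
  have EP s := in_L2Z_nrm (mult_coef s) (iterate_eigen s g1 fL).1.
  have part (q : nat -> int) :
     let F x :=
       \sum_(0 <= k < L) mult_coef (q k) * (f (zi (q k) x) - g ^ q k * f x) in
     in_L2 m F /\ nrm m F <= \sum_(0 <= k < L)
       modulus (mult_coef (q k)) * `|q k|%N%:R * (e / (K + 1) * nrm m f).
    move=> F; have -> : F = \sum_(0 <= k < L) ((fun x => mult_coef (q k) *
        (f (zi (q k) x) - g ^ q k * f x)) : X -> R[i]^o).
      by apply/funext => x; rewrite fct_sumE.
    split; first by apply: (sn_sum HN) => k; exact: (EP _).1.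
    apply: le_trans (sn_norm_sum HN _ _ _) _; first by move=> k; exact: (EP _).1.
    apply: ler_sum => k _; rewrite (EP _).2 -mulrA ler_wpM2l ?modulus_ge0//.
    by rewrite (le_trans (iterate_eigen _ g1 fL).2)// ler_wpM2l.
  have [pL pN] := part Posz; have [nL nN] := part Negz.
  have -> : (fun x => multL L f x - symbL L g * f x) = (fun x =>
      \sum_(0 <= k < L) mult_coef (Posz k) * (f (zi (Posz k) x) - g ^ Posz k * f x) +
      \sum_(0 <= k < L) mult_coef (Negz k) * (f (zi (Negz k) x) - g ^ Negz k * f x)).
    apply/funext => x; rewrite /multL /symbL mulrC zpart_mull zpartB /zpart.
    by congr (_ + _); apply: eq_bigr => k _; ring.
  have [sL sN] := in_L2D_nrm pL nL; split=> //.
  apply: le_trans sN _; apply: le_trans (lerD pN nN) _.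
  rewrite -!mulr_suml -mulrDl -/(zpart L (fun s => modulus (mult_coef s) * `|s|%N%:R)).
  rewrite -/K mulrA ler_wpM2r ?nrm_ge0// mulrCA ger_pMr//.
  by rewrite ler_pdivrMr ?ltr_wpDl// mul1r lerDl.
have symbdiff := in_L2Z_nrm (symbL L g - symb g) fL.
rewrite -(ler_pM2r f0) -SL.2.
have -> : (fun x => symb g * f x) = (fun x =>
    (mult f x - (mult f x - multL L f x)) -
    ((multL L f x - symbL L g * f x) + (symbL L g - symb g) * f x)).
  by apply/funext => x; ring.
have h1L : in_L2 m (fun x => mult f x - multL L f x) by exact: (sn_B HN TL TLL).
have h2L : in_L2 m (fun x => mult f x - (mult f x - multL L f x)).
  by exact: (sn_B HN TL h1L).
have h3 := in_L2D_nrm near.1 symbdiff.1.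
apply: le_trans (sn_normB HN h2L h3.1) _.
have := sn_normB HN TL h1L; have := h3.2; have := near.2; have := TC _ fL.
rewrite symbdiff.2.
have : modulus (symbL L g - symb g) * nrm m f <= mult_tail L * nrm m f.
  by rewrite ler_pM2r// modulus_dist; exact: symb_tail.
rewrite !mulrDl -mulrA; move: Tle.
set a1 := nrm m _; set a2 := nrm m _; set a3 := nrm m _; set a4 := nrm m _.
lra.
Qed.

End multipliers.

(** * The equivalence *)

Section absolute_sums.
Context {R : realType}.

(** The terms of each sign form one subset. *)
Lemma real_subset_sums (r : nat -> R) C n :
  (forall Q : pred nat, `|\sum_(0 <= k < n | Q k) r k| <= C) ->
  \sum_(0 <= k < n) `|r k| <= 2 * C.
Proof.
move=> rC; rewrite (bigID (fun k => 0 <= r k))/= mulr_natl mulr2n.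
apply: lerD.
  apply: le_trans (rC (fun k => 0 <= r k)); rewrite ler_normr; apply/orP; left.
  by apply: ler_sum => k k0; rewrite ger0_norm.
apply: le_trans (rC (fun k => ~~ (0 <= r k))); rewrite ler_normr; apply/orP; right.
rewrite -sumrN; apply: ler_sum => k; rewrite -ltNge => k0.
by rewrite ltr0_norm.
Qed.

Lemma complex_subset_sums (z : nat -> R[i]) C n :
  (forall Q : pred nat, modulus (\sum_(0 <= k < n | Q k) z k) <= C) ->
  \sum_(0 <= k < n) modulus (z k) <= 4 * C.
Proof.
move=> zC; rewrite (_ : 4 * C = 2 * C + 2 * C); last by ring.
apply: le_trans (_ : _ <= \sum_(0 <= k < n) `|complex.Re (z k)| +
    \sum_(0 <= k < n) `|complex.Im (z k)|) _.
  by rewrite -big_split/=; apply: ler_sum => k _; exact: modulus_le_ReIm.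
apply: lerD; apply: real_subset_sums => Q.
  by rewrite -Re_sum (le_trans (modulus_Re _)).
by rewrite -Im_sum (le_trans (modulus_Im _)).
Qed.

Lemma injective_sum_le (a : nat -> R) (pi : nat -> nat) n :
  (forall k, 0 <= a k) -> injective pi ->
  exists K, \sum_(0 <= k < n) a (pi k) <= \sum_(0 <= j < K) a j.
Proof.
move=> a0 inj; pose s := [seq pi k | k <- iota 0 n].
pose K := (\max_(k <- s) k).+1; exists K.
have sK j : j \in s -> (j < K)%N by move=> js; rewrite ltnS; exact: leq_bigmax_seq.
have us : uniq s by rewrite map_inj_uniq ?iota_uniq.
have ps : perm_eq s [seq j <- index_iota 0 K | j \in s].
  apply: uniq_perm; rewrite ?filter_uniq ?iota_uniq// => j.
  by rewrite mem_filter mem_index_iota/=; case: (boolP (j \in s)) => // /sK ->.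
have -> : \sum_(0 <= k < n) a (pi k) = \sum_(j <- s) a j.
  by rewrite big_map /index_iota subn0.
rewrite (perm_big _ ps) big_filter big_mkcond; apply: ler_sum => j _.
by case: ifP.
Qed.

End absolute_sums.

Section main.
Context {R : realType} {d : measure_display} {X : measurableType d}.
Context (m : probability X R) (tau tauV : X -> X) (mu : nat -> probability int R).
Context (tau_inv : measurable_inverse tau tauV).
Context (tau_pres : measure_preserving m tau).

Local Notation HN := (L2_complete_seminorm m).
Local Notation Dav f k := (fun x =>
  average tau tauV (mu k.+1) f x - average tau tauV (mu k) f x).
Local Notation Dhat g k := (fourier (mu k.+1) g - fourier (mu k) g).

Lemma difference_in_L2 f k : in_L2 m f -> in_L2 m (Dav f k).
Proof.
move=> fL; apply: (sn_B HN).
  exact: (average_tail tau_inv tau_pres (mu k.+1) 0 fL).1.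
exact: (average_tail tau_inv tau_pres (mu k) 0 fL).1.
Qed.

Lemma L2_series_nrm (F : nat -> X -> R[i]) : (forall k, in_L2 m (F k)) ->
  L2_series_converges m F <->
  exists s : X -> R[i]^o, in_L2 m s /\
    nrm m (\sum_(0 <= k < n) (F k : X -> R[i]^o) - s) @[n --> \oo] --> (0 : R).
Proof.
move=> FL.
have E (s : X -> R[i]) n : (fun x => \sum_(0 <= k < n) F k x - s x) =
    \sum_(0 <= k < n) (F k : X -> R[i]^o) - (s : X -> R[i]^o).
  by apply/funext => x; rewrite !fctE fct_sumE.
have EL (s : X -> R[i]) n : in_L2 m s ->
    in_L2 m (fun x => \sum_(0 <= k < n) F k x - s x).
  by move=> sL; rewrite E; apply: (sn_B HN) => //; exact: (sn_sum HN).
split=> -[s [sL cs]]; exists s; split=> //.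
  have /fine_cvg : L2norm m (fun x => \sum_(0 <= k < n) F k x - s x) @[n --> \oo] -->
    (0 : R)%:E := cs.
  by apply: cvg_trans; apply: near_eq_cvg; apply: nearW => n; rewrite -E.
apply: cvg_EFin.
  by apply: nearW => n; rewrite (L2norm_fin (EL s n sL)).
by apply: cvg_trans cs; apply: near_eq_cvg; apply: nearW => n; rewrite -E.
Qed.

(** With coefficients [e k] of modulus at most 1, the symbol of a partial sum of
    the rearranged series is bounded by [M] whatever the rearrangement; Von
    Neumann's inequality bounds the partial sums, and the parallelogram law
    does the rest. *)
Lemma bounded_symbols_imply_unconditional (M : R) f :
  (forall g : R[i], `|g| = 1 -> forall n, \sum_(0 <= k < n) modulus (Dhat g k) <= M) ->
  in_L2 m f -> L2_series_converges_unconditionally m (fun k => Dav f k).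
Proof.
move=> bM fL pi pib; apply/L2_series_nrm => [k|]; first exact: difference_in_L2.
have FL k : in_L2 m (Dav f (pi k)) by exact: difference_in_L2.
apply: (sn_cauchy_cvg HN (f := fun k => Dav f (pi k) : X -> R[i]^o)) => //.
apply: (bounded_signs_cauchy HN (C := M * nrm m f)) => //.
  by move=> f1 f2 L1 L2; exact: nrm_parallelogram.
move=> n e e1.
have -> : \sum_(0 <= k < n) e k *: (Dav f (pi k) : X -> R[i]^o) =
    mult tau tauV n e (fun k => mu (pi k).+1) (fun k => mu (pi k)) f.
  by apply/funext => x; rewrite fct_sumE.
apply: (mult_norm_le_symb tau_inv tau_pres) => // g g1.
have [K KP] := injective_sum_le n (fun k => modulus_ge0 (Dhat g k)) (bij_inj pib).
apply: le_trans (bM g g1 K); apply: le_trans KP.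
apply: le_trans (modulus_sum _ _ _) _; apply: ler_sum => k _.
by rewrite modulusM ler_piMl ?modulus_ge0.
Qed.

(** The coefficients 0 and 1 encode the subsets of the set of indices; for them
    the norms are bounded at each [f], hence uniformly, hence so are the
    subset sums of the symbols, uniformly on the circle. *)
Lemma unconditional_implies_bounded_symbols :
  non_atomic m -> ergodic m tau ->
  (forall f, in_L2 m f -> L2_series_converges_unconditionally m (fun k => Dav f k)) ->
  exists C : R, forall g : R[i], `|g| = 1 ->
    forall n, \sum_(0 <= k < n) modulus (Dhat g k) <= C.
Proof.
move=> na erg uc.
pose T (i : nat * pred nat) := mult tau tauV i.1 (fun k => (i.2 k)%:R)
  (fun k => mu k.+1) mu.
have [C CP] : exists C, forall i (f : X -> R[i]^o), in_L2 m f ->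
    nrm m (T i f) <= C * nrm m f.
  apply: (uniform_boundedness HN (Phi := fun i f => nrm m (T i f))
    (B := fun i => mult_tail i.1 (fun k => (i.2 k)%:R) (fun k => mu k.+1) mu 0)).
  - by move=> i f1 f2 L1 L2; exact: (mult_normD tau_inv tau_pres).
  - by move=> i c f fL; exact: (mult_normZ tau_inv tau_pres).
  - by move=> i f fL; exact: (mult_norm_le tau_inv tau_pres).
  move=> f fL.
  have FL k : in_L2 m (Dav f k) by exact: difference_in_L2.
  have [|C CP] := @unconditional_bounded _ _ _ _ HN (fun k => Dav f k) FL.
    by move=> pi pib; apply/L2_series_nrm => //; exact: uc.
  exists C => -[n Q]; apply: le_trans (CP n Q); rewrite le_eqVlt; apply/orP; left.
  apply/eqP; congr (nrm m _); apply/funext => x.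
  rewrite fct_sumE big_mkcond /T /mult/=; apply: eq_bigr => k _.
  by case: (Q k); rewrite ?mul1r// mul0r.
exists (4 * C) => g g1 n; apply: complex_subset_sums => Q.
apply: le_trans (symb_le_mult_norm tau_inv tau_pres na erg g1 (CP (n, Q))).
rewrite le_eqVlt; apply/orP; left; apply/eqP; congr modulus.
rewrite /symb/= big_mkcond/=; apply: eq_bigr => k _.
by case: (Q k); rewrite ?mul1r// mul0r.
Qed.

End main.

(* [mu k] is the (k+1)-st term of the sequence, so k = 0 is the first index. *)
Theorem theorem4p1 (R : realType) (d : measure_display) (X : measurableType d)
    (m : probability X R) (tau tauV : X -> X) (mu : nat -> probability int R)
    (m_non_atomic : non_atomic m)
    (tau_invertible : measurable_inverse tau tauV)
    (tau_preserving : measure_preserving m tau)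
    (tau_ergodic : ergodic m tau) :
  (forall f : X -> R[i], in_L2 m f ->
     L2_series_converges_unconditionally m
       (fun k x => average tau tauV (mu k.+1) f x - average tau tauV (mu k) f x))
  <->
  (ereal_sup
     [set (\sum_(0 <= k <oo)
             (modulus (fourier (mu k.+1) gamma - fourier (mu k) gamma)%R)%:E)%E
     | gamma in [set gamma : R[i] | (`|gamma| = 1)%R]] < +oo)%E.
Proof.
pose D (g : R[i]) k := modulus (fourier (mu k.+1) g - fourier (mu k) g).
have D0 g k : (0 <= (D g k)%:E)%E by rewrite lee_fin modulus_ge0.
split=> [uc|].
  have [C CP] := unconditional_implies_bounded_symbols tau_invertible
    tau_preserving m_non_atomic tau_ergodic uc.
  apply: (@le_lt_trans _ _ C%:E); last exact: ltry.
  apply: ge_ereal_sup => _ [g /= g1 <-].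
  apply: lime_le; first by apply: is_cvg_nneseries => k _ _; exact: D0.
  by apply: nearW => n; rewrite sumEFin lee_fin; exact: CP.
set S := ereal_sup _ => Sfin f fL.
have SP g : `|g| = 1 -> (\sum_(0 <= k <oo) (D g k)%:E <= S)%E.
  by move=> g1; apply: ereal_sup_ubound; exists g.
have S0 : (0 <= S)%E.
  by apply: le_trans (SP 1 (normr1 _)); apply: nneseries_ge0 => k _ _; exact: D0.
apply: (bounded_symbols_imply_unconditional tau_invertible tau_preserving
  (M := fine S)) fL => g g1 n.
rewrite -lee_fin fineK ?ge0_fin_numE// -sumEFin; apply: le_trans (SP g g1).
by apply: nneseries_lim_ge => k _ _; exact: D0.
Qed.
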